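(* There exists an absolute constant $C$ such that the following holds. Let $(r_n)_{n\ge0}$ be an admissible sequence, let $K$ be the associated random Cantor set in the independent rotations model, and suppose that $\lim_{r\to0}\mathbb{E}\,\mathrm{Fav}(K(r))=0$. Then $$\limsup_{r\to0}\frac{\mathrm{Fav}(K(r))}{\mathbb{E}\,\mathrm{Fav}(K(r))}\le C\qquad\text{almost surely}.$$
   Context: Favard length: for $\theta\in[0,\pi]$ let $\mathrm{proj}_\theta(x)=x\cdot(\cos\theta,\sin\theta)$ for $x\in\mathbb{R}^2$; for a Borel set $E\subset\mathbb{R}^2$, $\mathrm{Fav}(E)=\int_0^\pi|\mathrm{proj}_\theta(E)|\,d\theta$, where $|\cdot|$ is one-dimensional Lebesgue measure. For a compact set $E$ and $r>0$, $E(r)=\{x:\mathrm{dist}(x,E)\le r\}$. Admissible sequence: a sequence $r_0\ge r_1\ge r_2\ge\cdots$ of nonnegative reals with $r_{n+1}\le \frac13 r_n$ for all $n\ge0$. The degenerate case in which $r_n=0$ for all $n$ from some index on is allowed. Cantor set: let $[4]=\{0,1,2,3\}$, let $[4]^*$ be the set of finite words over $[4]$ (including the empty word $\varnothing$), and let $|\mathbf{i}|$ be the length of $\mathbf{i}$. Write $B(x,r)$ for the closed disc and $u(t)=(\cos t,\sin t)$. Given an admissible sequence $(r_n)$ and angles $(\omega_{\mathbf i})_{\mathbf i\in[4]^*}$ in $[0,2\pi]$, define $D_\varnothing=B(0,r_0)$, and if $|\mathbf i|=k$ and $D_{\mathbf i}=B(c_{\mathbf i},r_k)$, then for $j\in[4]$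 put $D_{\mathbf i j}=B\big(c_{\mathbf i}+(r_k-r_{k+1})\,u(\omega_{\mathbf i}+\tfrac{2\pi j}{4}),\,r_{k+1}\big)$. Set $K_n=\bigcup_{|\mathbf i|=n}D_{\mathbf i}$ and $K=\bigcap_{n\ge0}K_n$. Independent rotations model: the radii are fixed and all angles $\omega_{\mathbf i}$, $\mathbf i\in[4]^*$, are independent random variables uniform in $[0,2\pi]$. *)

(* Defs.v *)
From HB Require Import structures.
From mathcomp Require Import all_boot all_order all_algebra.
From mathcomp Require Import all_classical all_reals all_analysis.

Set Implicit Arguments.
Unset Strict Implicit.
Unset Printing Implicit Defensive.

Import Order.TTheory GRing.Theory Num.Theory.
Import numFieldNormedType.Exports.

Local Open Scope classical_set_scope.
Local Open Scope ring_scope.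

Section plane.
Context {R : realType}.
Implicit Types (x y c : R * R) (E : set (R * R)) (t rho : R).

(* The library's norm on R * R is the sup norm, so the Euclidean distance is
   written out. *)
Definition eucl_dist x y : R :=
  Num.sqrt ((x.1 - y.1) ^+ 2 + (x.2 - y.2) ^+ 2).

Definition unitv t : R * R := (cos t, sin t).

Definition disc c rho : set (R * R) := [set x | eucl_dist x c <= rho].

(* The infimum is taken in \bar R, so that the distance to set0 is +oo. *)
Definition dist_to E x : \bar R := ereal_inf [set (eucl_dist x y)%:E | y in E].

Definition nbhd E rho : set (R * R) := [set x | (dist_to E x <= rho%:E)%E].

Definition proj_angle t x : R := x.1 * cos t + x.2 * sin t.

Definition Fav E : \bar R :=
  (\int[lebesgue_measure]_(t in `[0%R, pi])
      lebesgue_measure (proj_angle t @` E))%E.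

End plane.

(* Words are stored with their last letter first: the word written "i j" on
   paper is j :: i. *)
Notation word := (seq 'I_4).

Section cantor_set.
Context {R : realType}.
Variables (r : nat -> R) (omega : word -> R).

Definition admissible : Prop :=
  [/\ forall n, 0 <= r n,
      forall n, r n.+1 <= r n &
      forall n, r n.+1 <= r n / 3].

Fixpoint center (i : word) : R * R :=
  if i is j :: i' then
    let s := r (size i') - r (size i').+1 in
    let u := unitv (omega i' + 2 * pi * j%:R / 4) in
    ((center i').1 + s * u.1, (center i').2 + s * u.2)
  else (0, 0).

Definition word_disc (i : word) : set (R * R) := disc (center i) (r (size i)).

Definition cantor_approx (n : nat) : set (R * R) :=
  \bigcup_(i in [set i : word | size i = n]) word_disc i.

Definition cantor_set : set (R * R) := \bigcap_n cantor_approx n.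

End cantor_set.

Section independent_rotations.
Context d (T : measurableType d) (R : realType) (P : probability T R).

Definition mutually_independent (I : choiceType) (X : I -> {RV P >-> R})
    : Prop :=
  forall (s : seq I) (B : I -> set R),
    uniq s -> (forall i, measurable (B i)) ->
    P (\bigcap_(i in [set` s]) (X i @^-1` B i)) =
    (\prod_(i <- s) P (X i @^-1` B i))%E.

Lemma mul2pi_gt0 : 0 < 2 * pi :> R.
Proof. by rewrite mulr_gt0// pi_gt0. Qed.

Definition uniform_angle (X : {RV P >-> R}) : Prop :=
  forall B : set R, measurable B ->
    distribution P X B = uniform_prob mul2pi_gt0 B.

Definition independent_rotations (omega : word -> {RV P >-> R}) : Prop :=
  mutually_independent omega /\ forall i, uniform_angle (omega i).

Variables (r : nat -> R) (omega : word -> {RV P >-> R}).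

Definition random_cantor_set (w : T) : set (R * R) :=
  cantor_set r (fun i => omega i w).

Definition Fav_nbhd (rho : R) (w : T) : \bar R :=
  Fav (nbhd (random_cantor_set w) rho).

(* The library's 'E_P[X] only takes real-valued X, whereas Fav is
   \bar R-valued; this is the integral 'E_P[X] unfolds to. *)
Definition EFav_nbhd (rho : R) : \bar R := (\int[P]_w Fav_nbhd rho w)%E.

End independent_rotations.

(* Main.v *)
From Pilot Require Import Defs.
From HB Require Import structures.
From mathcomp Require Import all_boot all_order all_algebra.
From mathcomp Require Import all_classical all_reals all_analysis.
From mathcomp Require Import measurable_realfun.
From mathcomp Require Import ring lra zify.

Set Implicit Arguments.
Unset Strict Implicit.
Unset Printing Implicit Defensive.

Import Order.TTheory GRing.Theory Num.Theory.
Import numFieldNormedType.Exports.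

Local Open Scope classical_set_scope.
Local Open Scope ring_scope.

(** Fix a radius s, let n be the generation whose discs have radius about s, and
replace the radius of that generation by some rho comparable to s. Up to
absolute constants, Fav of the s-neighbourhood of K is the integral over theta
of the length of the shadow in direction theta: the union of the 4^n intervals
of radius rho around the projected centers ([shadow_integral_le_Fav],
[Fav_le_shadow_integral]).

The scale of this quantity is governed by the energy
E(s) = sum over k <= n of 1 / (4^k r_k), with r_n replaced by rho: the expected
length of a shadow is comparable to 1 / E(s), uniformly in the direction
([mean_shadow_energy]). Indeed a shadow is the union of four shifted
independent copies of the shadow for the sequence r_1, r_2, ..., and the
relative shift of two copies is a cos(omega + b) with omega uniform and a
comparable to r_0. The density of such a shift is of order 1 / r_0 on the range
that matters ([overlap_lower], [overlap_upper]), so two copies of expected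
length q overlap on a set of expected length of order q^2 / r_0. Hence the
expected length is 4 q minus a term of order q^2 / r_0, and its inverse is, up
to constants, 1 / (4 q) + 1 / r_0; this is the recursion satisfied by the
energy.

For the almost sure bound, cut the tree at a generation m. Fav is at most the
sum of the contributions of the 4^m pieces below generation m, which are
independent and bounded by 8 r_m. If the first m terms carry at most half of
E(s), the mean of this sum is at most a constant over E(s), and its variance is
at most 4^m (8 r_m)^2 ([piece_sum_moments]). Choose m as the first index at which
the partial energy e_m exceeds half of E(s) ([scale_dichotomy]). Either
the last term 1 / (4^m r_m) is at least half of e_m; then the trivial bound
8 4^m r_m is already at most a constant over E(s). Or E(s) lies between e_m and
2 e_m; then a single event, of probability at most a constant times
4^m r_m^2 e_m^2 by Chebyshev, controls all such radii s at once
([class_deviation]). Since r_{k+1} <= r_k / 3, this probability is at most a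
constant times (4/9)^m ([radius_energy_le]), and Borel-Cantelli applies
([almost_sure_deviation]). As the expectation of Fav tends to 0, E(s) tends to
infinity, so only large m occur for small s. *)

(** * Lipschitz images and Lebesgue measure *)

Lemma sume_const (R : realDomainType) n (x : \bar R) :
  (\sum_(i < n) x = n%:R%:E * x)%E.
Proof.
rewrite mule_natl; elim: n => [|n IH]; first by rewrite big_ord0 mule0n.
by rewrite big_ord_recl IH muleS.
Qed.

Section lipschitz_images.
Context {R : realType}.
Local Notation mu := (@lebesgue_measure R).

(** As a function on all sets, [lebesgue_measure] is an outer measure, so that
it can be applied to the projections of the random neighbourhoods. *)
Lemma le_lebesgue_measure (A B : set R) : A `<=` B -> (mu A <= mu B)%E.
Proof. by move=> AB; exact: (@le_outer_measure _ _ (wlength idfun)^*%mu). Qed.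

Lemma lebesgue_measure_translate (c : R) (A : set R) : measurable A ->
  mu [set x | A (x - c)] = mu A.
Proof.
move=> mA.
have mc : @measurable_fun _ _ (measurableTypeR R) (measurableTypeR R) setT
    (fun x => x - c).
  exact: measurable_funB.
pose image := [the measure _ _ of pushforward mu ((fun x => x - c) :
  measurableTypeR R -> measurableTypeR R)].
pose nu := image mc.
suff -> : mu A = nu A by [].
apply: lebesgue_measure_unique => //= _ [[a b]] _ <-.
rewrite /nu/= /pushforward.
have -> : (fun x : R => x - c) @^-1` `]a, b] = `]a + c, b + c]%classic.
  by apply/seteqP; split => x /=; rewrite !in_itv/=; lra.
by rewrite !lebesgue_measure_itv/= !lte_fin ltrD2r -!EFinD opprD addrACA subrr addr0.
Qed.

(** A cover of the values of v by open intervals yields, interval by interval, a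
cover of the values of u by intervals at most 2 L times as long. Stating it for
two functions on an index set covers both the image under a Lipschitz map and
the preimage under a map with Lipschitz inverse. *)
Lemma lipschitz_lebesgue_measure (I : Type) (D : set I) (u v : I -> R) (L : R) :
  0 < L -> (forall i j, D i -> D j -> `|u i - u j| <= L * `|v i - v j|) ->
  (mu (u @` D) <= (2 * L)%:E * mu (v @` D))%E.
Proof.
move=> L0 uv.
rewrite -lee_pdivrMl; last by rewrite mulr_gt0.
rewrite [leRHS]/lebesgue_measure/= /lebesgue_stieltjes_measure /measure_extension/=.
(* The outer measure of the values of v as an infimum over open covers. *)
rewrite outer_measure_open_itv_cover; apply: le_ereal_inf_tmp => _ /= [F [oF vF] <-].
rewrite lee_pdivrMl; last by rewrite mulr_gt0.
rewrite -nneseriesZl; last by move=> i _; exact: wlength_ge0.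
pose E k := u @` (D `&` v @^-1` F k).
have uE : u @` D `<=` \bigcup_k E k.
  move=> _ [i Di <-]; have [k _ Fk] : (\bigcup_k F k) (v i) by apply: vF; exists i.
  by exists k => //; exists i.
apply: (le_trans (le_lebesgue_measure uE)).
apply: (le_trans (@outer_measure_sigma_subadditive _ _ (wlength idfun)^*%mu E)).
apply: lee_nneseries => // k _.
have [[a b] /= Fab] := oF k; rewrite Fab wlength_itv/= lte_fin.
have [[i0 [Di0 /= vi0]]|E0] := pselect ((D `&` v @^-1` F k) !=set0); last first.
  have -> : E k = set0.
    by apply/seteqP; split => // x [i Di _]; apply: E0; exists i.
  rewrite (@outer_measure0 _ _ (wlength idfun)^*%mu) mule_ge0// ?lee_fin ?mulr_ge0 ?(ltW L0)//.
  by case: ifPn => // ab; rewrite -EFinD lee_fin subr_ge0 ltW.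
move: vi0; rewrite Fab/= in_itv/= => /andP[ai0 i0b].
rewrite (lt_trans ai0 i0b).
have sub : E k `<=` `[u i0 - L * (b - a), u i0 + L * (b - a)].
  move=> x [i [Di +] <-]; rewrite /= Fab/= in_itv/= => /andP[ai ib].
  rewrite in_itv/=.
  have : `|u i - u i0| <= L * (b - a).
    apply: (le_trans (uv _ _ Di Di0)); rewrite ler_pM2l// ler_norml; lra.
  by rewrite ler_norml; lra.
apply: (le_trans (le_lebesgue_measure sub)).
rewrite [leLHS]lebesgue_measure_itv/= lte_fin.
case: ifPn => _; first by rewrite -!EFinD -EFinM lee_fin; lra.
by rewrite -EFinD -EFinM lee_fin mulr_ge0 ?mulr_ge0 ?(ltW L0)//; lra.
Qed.

End lipschitz_images.

(** * Distribution of the cosine of a uniform angle *)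

Definition uniform_turn {R : realType} : probability (measurableTypeR R) R :=
  uniform_prob (mul2pi_gt0 R).

Section cosine_density.
Context {R : realType}.
Local Notation mu := (@lebesgue_measure R).

Lemma cos_lipschitz (x y : R) : `|cos x - cos y| <= `|x - y|.
Proof.
wlog xy : x y / x <= y => [H|].
  have [/H//|/ltW/H] := leP x y; by rewrite distrC (distrC y).
have dcos z : z \in `]x, y[ -> is_derive z 1 (@cos R) (- sin z).
  by move=> _; exact: is_derive_cos.
have [z _ cz] := @MVT_segment _ (@cos R) (fun z => - sin z) _ _ xy dcos
  (continuous_subspaceT (@continuous_cos R)).
rewrite distrC cz normrM normrN (distrC x).
by rewrite ler_piMl// sin_max.
Qed.

(** The derivative of acos is at most sqrt 2 in absolute value on this range. *)
Lemma acos_lipschitz (s t : R) : s ^+ 2 <= 1 / 2 -> t ^+ 2 <= 1 / 2 ->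
  `|acos s - acos t| <= 2 * `|s - t|.
Proof.
wlog st : s t / s <= t => [H s2 t2|s2 t2].
  have [/H->//|/ltW/H] := leP s t; by rewrite distrC (distrC t); apply.
have range (z : R) : z \in `[s, t] -> z ^+ 2 <= 1 / 2.
  by rewrite in_itv/= => /andP[sz zt]; case: (leP 0 z) => z0; nra.
have rangeo (z : R) : z ^+ 2 <= 1 / 2 -> -1 < z < 1.
  by move=> z2; apply/andP; split; nra.
have dacos z : z \in `]s, t[ -> is_derive z 1 (@acos R) (- (Num.sqrt (1 - z ^+ 2))^-1).
  move=> zst; apply: is_derive1_acos; apply/rangeo/range.
  by apply: subset_itv_oo_cc zst.
have cacos : {within `[s, t], continuous (@acos R)}.
  apply: continuous_in_subspaceT => z; rewrite inE/= => zst.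
  by apply: continuous_acos; apply/rangeo/range.
have [z zst e] := MVT_segment st dacos cacos.
rewrite distrC e distrC normrM ler_wpM2r// normrN ger0_norm ?invr_ge0 ?sqrtr_ge0//.
rewrite -[2]invrK lef_pV2 ?posrE ?invr_gt0//; last first.
  by rewrite sqrtr_gt0; have := range _ zst; lra.
by rewrite -[leLHS]ger0_norm ?invr_ge0// -sqrtr_sqr ler_sqrt; have := range _ zst; nra.
Qed.

Lemma cosDnpi (x : R) n : cos (x + n%:R * pi) = (-1) ^+ n * cos x.
Proof.
elim: n => [|n IH]; first by rewrite mul0r addr0 expr0 mul1r.
by rewrite -natr1 mulrDl mul1r addrA cosDpi IH exprS mulN1r mulNr.
Qed.

Lemma cosine_surjective (b y : R) : 0 <= b -> -1 <= y <= 1 ->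
  exists2 x, 0 <= x <= 2 * pi & cos (x + b) = y.
Proof.
move=> b0 y1.
have cosy : cos (acos y) = y by rewrite acosK// in_itv.
have acosy : 0 <= acos y <= pi by rewrite acos_ge0// acos_lepi.
have ex : exists n : nat, b <= acos y + n%:R * (2 * pi).
  exists (Num.truncn (b / (2 * pi))).+1.
  have := truncnS_gt (b / (2 * pi)).
  rewrite ltr_pdivrMr ?mulr_gt0 ?pi_gt0// => H; lra.
case: (ex_minnP ex) => n bn nmin.
exists (acos y + n%:R * (2 * pi) - b).
  apply/andP; split; first by lra.
  case: n bn nmin => [|n] bn nmin; first by rewrite mul0r addr0; have := pi_gt0 R; lra.
  have : ~~ (b <= acos y + n%:R * (2 * pi)).
    by apply/negP => /nmin; rewrite ltnn.
  rewrite -ltNge -natr1 mulrDl mul1r; lra.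
rewrite subrK.
have -> : n%:R * (2 * pi) = (n * 2)%:R * pi :> R by rewrite natrM; ring.
by rewrite cosDnpi exprM sqrr_sign mul1r.
Qed.

Local Notation U := (@uniform_turn R).

Lemma uniform_turnE (E : set R) : measurable E ->
  U E = ((2 * pi)^-1%:E * mu (E `&` `[0%R, (2 * pi)%R]))%E.
Proof.
move=> mE.
have mI : measurable (E `&` `[0%R, (2 * pi)%R]) by exact: measurableI.
rewrite [LHS]integral_uniform_pdf.
rewrite (eq_integral (cst (2 * pi)^-1%:E)); last first.
  move=> x; rewrite inE/= in_itv/= => -[_ x2].
  by rewrite /uniform_pdf x2 subr0.
by rewrite integral_cst.
Qed.

(** The map x |-> a cos(x + b) is a-Lipschitz and covers [- a, a] within one
turn, so it cannot send a small set of angles onto a large set of values. *)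
Lemma cosine_density_lower (a b : R) (E : set R) : 0 < a -> 0 <= b ->
  measurable E -> E `<=` `[- a, a] ->
  (mu E <= (4 * pi * a)%:E * U [set x | E (a * cos (x + b))%R])%E.
Proof.
move=> a0 b0 mE Ea.
have mS : measurable [set x | E (a * cos (x + b))].
  rewrite -[X in measurable X]setTI.
  have : measurable_fun setT (fun x : R => a * cos (x + b)).
    apply: measurable_funM => //; apply: measurableT_comp; last exact: measurable_funD.
    by apply: continuous_measurable_fun; exact: continuous_cos.
  by move=> mf; exact: mf.
rewrite uniform_turnE// muleA -EFinM.
set S := _ `&` _.
have -> : 4 * pi * a * (2 * pi)^-1 = 2 * a.
  by have := pi_gt0 R; move: (@pi R) => p p0; field; rewrite gt_eqF.
have lip x y : S x -> S y ->
    `|a * cos (x + b) - a * cos (y + b)| <= a * `|x - y|.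
  move=> _ _; rewrite -mulrBr normrM (gtr0_norm a0) ler_wpM2l ?(ltW a0)//.
  by rewrite (le_trans (cos_lipschitz _ _))// opprD addrACA subrr addr0.
have := @lipschitz_lebesgue_measure R R S (fun x => a * cos (x + b)) id a a0 lip.
rewrite image_id; apply: le_trans.
apply: le_lebesgue_measure => y Ey.
have /= := Ea _ Ey; rewrite in_itv/= => /andP[y1 y2].
have ya : -1 <= y / a <= 1 by rewrite ler_pdivlMr// ler_pdivrMr// mul1r mulN1r y1.
have [x xpi cx] := cosine_surjective b0 ya.
have yE : a * cos (x + b) = y by rewrite cx mulrC divfK// gt_eqF.
by exists x => //; split; rewrite /= ?in_itv//= yE.
Qed.

(** Away from its extreme values the cosine has a Lipschitz inverse on every
half period, and a turn starting at b meets at most N + 2 half periods. The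
bound on E keeps the values away from the extremes, where the density blows up.
*)
Lemma cosine_density_upper (a b : R) (N : nat) (E : set R) : 0 < a ->
  0 <= b <= N%:R * pi -> measurable E ->
  (forall x, E x -> 2 * x ^+ 2 <= a ^+ 2) ->
  (U [set x | E (a * cos (x + b))%R] <= (2 * N.+2%:R / (pi * a))%:E * mu E)%E.
Proof.
move=> a0 /andP[b0 bN] mE Ea.
have mS : measurable [set x | E (a * cos (x + b))].
  rewrite -[X in measurable X]setTI.
  have : measurable_fun setT (fun x : R => a * cos (x + b)).
    apply: measurable_funM => //; apply: measurableT_comp; last exact: measurable_funD.
    by apply: continuous_measurable_fun; exact: continuous_cos.
  by move=> mf; exact: mf.
rewrite uniform_turnE//.
set S := _ `&` _.
(* The angles in the half period number k. *)
pose S_ (k : nat) := S `&` [set x | k%:R * pi <= x + b <= k.+1%:R * pi].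
have SS : S `<=` \big[setU/set0]_(k < N.+2) S_ k.
  move=> x Sx; rewrite -bigcup_mkord.
  have : (0 <= (x + b) / pi).
    move: Sx; rewrite /S/= in_itv/= => -[_ /andP[x0 _]].
    by rewrite divr_ge0 ?pi_ge0// addr_ge0.
  move=> xb0; have /andP[k1 k2] := truncn_itv xb0.
  move: k1 k2; set k := Num.truncn _.
  rewrite ler_pdivlMr ?pi_gt0// ltr_pdivrMr ?pi_gt0// => k1 k2.
  have [kN|kN] := ltnP k N.+2.
    by exists k => //; split => //=; rewrite k1 ltW.
  exists N.+1; first exact: ltnSn.
  split => //=.
  move: Sx; rewrite /S/= in_itv/= => -[_ /andP[x0 x2]].
  apply/andP; split.
    apply: le_trans k1; rewrite ler_wpM2r ?pi_ge0// ler_nat ltnW//.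
  by rewrite -!natr1; lra.
have S_E k : (mu (S_ k) <= (4 / a)%:E * mu E)%E.
  have a20 : 0 < 2 / a by rewrite divr_gt0.
  have := @lipschitz_lebesgue_measure R R (S_ k) id (fun x => a * cos (x + b)) _ a20.
  rewrite image_id => H.
  apply: (@le_trans _ _ ((2 * (2 / a))%:E * mu ((fun x => a * cos (x + b))%R @` S_ k))%E).
    apply: H => x y [[/= Ex _]] /andP[xk1 xk2] [[/= Ey _] /andP[yk1 yk2]].
    have key z : k%:R * pi <= z <= k.+1%:R * pi ->
        acos (cos (z - k%:R * pi)) = z - k%:R * pi.
      move=> /andP[z1 z2]; rewrite cosK// in_itv/=; apply/andP; split; first by lra.
      by move: z2; rewrite -natr1; lra.
    have half z : E (a * cos z) -> cos (z - k%:R * pi) ^+ 2 <= 1 / 2.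
      move=> /Ea; rewrite exprMn.
      rewrite -{1}(subrK (k%:R * pi) z) cosDnpi exprMn sqrr_sign mul1r => H'.
      have : 0 < a ^+ 2 by rewrite exprn_gt0.
      by move: H'; set c := cos _ ^+ 2; set A := a ^+ 2 => ? ?; nra.
    have e1 : x - y = acos (cos (x + b - k%:R * pi)) - acos (cos (y + b - k%:R * pi)).
      by rewrite !key ?xk1 ?yk1//; ring.
    rewrite e1 (le_trans (acos_lipschitz (half _ Ex) (half _ Ey)))//.
    have -> : cos (x + b - k%:R * pi) - cos (y + b - k%:R * pi) =
        (-1) ^+ k * (cos (x + b) - cos (y + b)).
      rewrite -[in RHS](subrK (k%:R * pi) (x + b)) -[in RHS](subrK (k%:R * pi) (y + b)).
      by rewrite !cosDnpi -mulrBr mulrA -expr2 sqrr_sign mul1r.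
    rewrite normrM normrX normrN1 expr1n mul1r -mulrBr normrM (gtr0_norm a0).
    by rewrite mulrA divfK// gt_eqF.
  have -> : 2 * (2 / a) = 4 / a by field; rewrite gt_eqF.
  rewrite lee_pmul2l ?lte_fin ?divr_gt0//.
  by apply: le_lebesgue_measure => _ [x [[/= Ex _] _] <-].
have mS_ k : measurable (S_ k).
  apply: measurableI; first exact: measurableI.
  rewrite (_ : [set _ | _] = `[k%:R * pi - b, k.+1%:R * pi - b]%classic)//.
  by apply/seteqP; split => x /=; rewrite in_itv/=; lra.
have -> : (2 * N.+2%:R / (pi * a))%:E = ((2 * pi)^-1%:E * (N.+2%:R * (4 / a))%:E)%E.
  by rewrite -EFinM; congr (_%:E); have := pi_gt0 R; move: (@pi R) => p p0;
  field; rewrite !gt_eqF.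
rewrite -muleA lee_pmul2l ?lte_fin ?invr_gt0 ?mulr_gt0 ?pi_gt0//.
apply: (le_trans (le_lebesgue_measure SS)).
apply: (le_trans (le_mu_bigsetU mu (fun i _ => mS_ i))).
apply: (le_trans (lee_sum _ (fun (i : 'I_N.+2) _ => S_E i))).
by rewrite sume_const muleA -EFinM.
Qed.

(** * Overlap of a set with a randomly shifted set *)

Section overlap.
Variables (a b : R) (G H : set R).
Hypotheses (a0 : 0 < a) (b0 : 0 <= b) (mG : measurable G) (mH : measurable H).

Let measurable_hit y : measurable [set x | H (y + a * cos (x + b))].
Proof.
have mf : measurable_fun setT (fun x : R => y + a * cos (x + b)).
  apply: measurable_funD => //; apply: measurable_funM => //.
  apply: measurableT_comp; last exact: measurable_funD.
  by apply: continuous_measurable_fun; exact: continuous_cos.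
by rewrite -[X in measurable X]setTI; exact: mf.
Qed.

Let overlap_set : set (measurableTypeR R * measurableTypeR R) :=
  [set z | G z.2 /\ H (z.2 + a * cos (z.1 + b))].

Let measurable_overlap_set : measurable overlap_set.
Proof.
have m2 : measurable_fun setT (fun z : measurableTypeR R * measurableTypeR R => z.2 : R).
  exact: measurable_snd.
have m1 : measurable_fun setT (fun z : measurableTypeR R * measurableTypeR R => z.1 : R).
  exact: measurable_fst.
have mf : measurable_fun setT (fun z : measurableTypeR R * measurableTypeR R =>
    z.2 + a * cos (z.1 + b) : R).
  apply: measurable_funD => //; apply: measurable_funM => //.
  apply: measurableT_comp; last exact: measurable_funD.
  by apply: continuous_measurable_fun; exact: continuous_cos.
apply: measurableI.
  by rewrite -[X in measurable X]setTI; exact: m2.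
by rewrite -[X in measurable X]setTI; exact: mf.
Qed.

Let measurable_hit_prob : @measurable_fun _ _ (measurableTypeR R) _ G
  (fun y => U [set x | H (y + a * cos (x + b))%R]).
Proof.
have := measurable_fun_ysection U measurable_overlap_set.
move=> /(measurable_funS measurableT (@subsetT _ G)); apply: eq_measurable_fun.
move=> y; rewrite inE => Gy /=; congr (U _).
apply/seteqP; split => x /=; rewrite /ysection/= inE; first by case.
by split.
Qed.

(** Exchanging the integrals reduces the expected overlap to the distribution of
the random shift, for one fixed point y of G at a time. *)
Lemma overlap_fubini :
  (\int[U]_x mu [set y | G y /\ H (y + a * cos (x + b))%R] =
   \int[mu]_(y in G) U [set x | H (y + a * cos (x + b))%R])%E.
Proof.
have := indic_fubini_tonelli U mu measurable_overlap_set.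
rewrite indic_fubini_tonelli_FE// indic_fubini_tonelli_GE// => e.
rewrite [RHS]integral_mkcond.
transitivity (\int[U]_x (mu \o xsection overlap_set) x)%E.
  apply: eq_integral => x _ /=; congr (mu _).
  by apply/seteqP; split => y /=; rewrite /xsection/= inE.
rewrite e; apply: eq_integral => y _ /=; rewrite patchE.
case: ifPn; rewrite (inE, notin_setE) => Gy.
  congr (U _); apply/seteqP; split => x /=; rewrite /ysection/= inE; first by case.
  by split.
rewrite (_ : ysection _ _ = set0) ?measure0//.
by apply/seteqP; split => x //=; rewrite /ysection/= inE => -[].
Qed.

Let mu_translate y : mu [set t | H (y + t)] = mu H.
Proof.
rewrite -[RHS](@lebesgue_measure_translate _ (- y))//; congr (mu _).
by apply/seteqP; split => t /=; rewrite opprK addrC.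
Qed.

Let measurable_translate y : measurable [set t | H (y + t)].
Proof.
have mf : measurable_fun setT (fun t : R => y + t) by exact: measurable_funD.
by rewrite -[X in measurable X]setTI; exact: mf.
Qed.

Variable c : R.
Hypotheses (Gc : G `<=` `[- c, c]) (Hc : H `<=` `[- c, c]).

(** The differences of points of G and H lie in [- 2 c, 2 c], hence within the
range [- a, a] of the shift. *)
Lemma overlap_lower : 2 * c <= a ->
  (mu G * mu H <= (4 * pi * a)%:E *
    \int[U]_x mu [set y | G y /\ H (y + a * cos (x + b))%R])%E.
Proof.
move=> ca; rewrite overlap_fubini.
rewrite -ge0_integralZl//; last by rewrite lee_fin !mulr_ge0 ?pi_ge0 ?(ltW a0).
rewrite muleC -integral_cst//; apply: ge0_le_integral => //.
- exact: measurable_funeM.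
move=> y Gy; rewrite -(mu_translate y).
apply: (@cosine_density_lower a b [set t | H (y + t)]) => // t /= /Hc.
have := Gc Gy; rewrite /= !in_itv/=; lra.
Qed.

(** The differences of points of G and H lie in [- 2 c, 2 c], where the density
of the shift is bounded. *)
Lemma overlap_upper N : b <= N%:R * pi -> 8 * c ^+ 2 <= a ^+ 2 ->
  (\int[U]_x mu [set y | G y /\ H (y + a * cos (x + b))%R] <=
   (2 * N.+2%:R / (pi * a))%:E * (mu G * mu H))%E.
Proof.
move=> bN ca; rewrite overlap_fubini muleCA muleC -integral_cst//.
apply: ge0_le_integral => //.
move=> y Gy; rewrite -(mu_translate y).
apply: (@cosine_density_upper a b N [set t | H (y + t)]) => //.
  by rewrite b0.
move=> t /= /Hc; have := Gc Gy; rewrite /= !in_itv/= => /andP[? ?] /andP[? ?].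
apply: le_trans ca.
have : t ^+ 2 <= (2 * c) ^+ 2; last by lra.
by have [t0|t0] := leP 0 t; nra.
Qed.

End overlap.
End cosine_density.

(** * Independence and product integrals *)

Section pi_lambda_independence.
Context d1 d2 (T1 : measurableType d1) (T2 : measurableType d2) (R : realType).
Variable m : probability T1 R.

(** Both sides are finite measures in C; they agree on a pi-system that
generates the sigma-algebra. *)
Lemma pi_lambda_independence (Y : T1 -> T2) (G : set (set T2)) (E : set T1) :
  measurable_fun setT Y -> measurable = <<s G >> -> setI_closed G -> G setT ->
  measurable E ->
  (forall C, G C -> m (E `&` Y @^-1` C) = m E * m (Y @^-1` C))%E ->
  forall C, measurable C -> (m (E `&` Y @^-1` C) = m E * m (Y @^-1` C))%E.
Proof.
move=> mY mG GI GT mE HG C mC.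
have finE : m E \is a fin_num by exact: fin_num_measure.
have E0 : 0 <= fine (m E) by rewrite fine_ge0.
pose Ym : {mfun T1 >-> T2} := mfun_Sub (mem_set mY).
pose restricted : {measure set T1 -> \bar R} := mrestr m mE.
pose image_measure := [the measure _ _ of pushforward restricted Y].
pose m1 := image_measure mY.
pose m2 : {measure set T2 -> \bar R} := mscale (NngNum E0) (distribution m Ym).
have m1E A : m1 A = m (E `&` Y @^-1` A).
  by rewrite /m1 /= /pushforward /mrestr setIC.
have m2E A : m2 A = (m E * m (Y @^-1` A))%E.
  by rewrite /m2 /= /mscale /= /pushforward fineK.
rewrite -m1E -m2E; apply: (g_sigma_algebra_measure_unique G _ (fun=> setT)).
- by move=> A GA; rewrite mG; exact: sub_sigma_algebra.
- by move=> _.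
- by rewrite bigcup_const//; exists 0%N.
- exact: GI.
- by move=> A GA; rewrite m1E m2E HG.
- by move=> _; rewrite m1E (le_lt_trans (probability_le1 _ _)) ?ltry// preimage_setT setIT.
- by rewrite -mG.
Qed.

Lemma integral_independent_pair d3 (T3 : measurableType d3) (X : T1 -> T2) (Y : T1 -> T3)
    (F : T2 * T3 -> \bar R) :
  measurable_fun setT X -> measurable_fun setT Y ->
  (forall A B, measurable A -> measurable B ->
    m (X @^-1` A `&` Y @^-1` B) = m (X @^-1` A) * m (Y @^-1` B))%E ->
  measurable_fun setT F -> (forall z, 0 <= F z)%E ->
  (\int[m]_t F (X t, Y t) = \int[m]_s \int[m]_t F (X s, Y t))%E.
Proof.
move=> mX mY XY mF F0.
have mXY : measurable_fun setT (fun t => (X t, Y t)) by exact: measurable_fun_pair.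
pose Xm : {mfun T1 >-> T2} := mfun_Sub (mem_set mX).
pose Ym : {mfun T1 >-> T3} := mfun_Sub (mem_set mY).
pose XYm : {mfun T1 >-> (T2 * T3)%type} := mfun_Sub (mem_set mXY).
pose mx : probability T2 R := distribution m Xm.
pose my : probability T3 R := distribution m Ym.
transitivity (\int[distribution m XYm]_z F z)%E.
  by rewrite ge0_integral_distribution.
have := @fubini_tonelli1 _ _ _ _ _ mx my F mF F0.
rewrite -(@eq_measure_integral _ _ _ _ _ (distribution m XYm)); last first.
  by move=> A mA _; apply/esym; apply: product_measure_unique.
move=> ->.
rewrite ge0_integral_distribution//=; last 2 first.
- exact: measurable_fun_fubini_tonelli_F.
- by move=> x; apply: integral_ge0 => y _.
apply: eq_integral => s _; rewrite /fubini_F/= ge0_integral_distribution//=.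
exact: measurableT_comp.
Qed.

End pi_lambda_independence.

(** * The space of rotations *)

Section rotation_space.
Context {R : realType}.
Implicit Types (W : set word) (tau : word -> word).

Definition coordinate_set (s : seq word) (B : word -> set R) :
    set (word -> R) :=
  [set f | forall i, i \in s -> B i (f i)].

(** Events that constrain only the angles of finitely many words of W. The
cylinders over all words generate the product sigma-algebra; those over disjoint
sets of words are the source of independence. *)
Definition word_cylinder W : set (set (word -> R)) :=
  [set A | exists s B, [/\ forall i, i \in s -> W i,
    forall i, measurable (B i) & A = coordinate_set s B]].

Lemma word_cylinderI W : setI_closed (word_cylinder W).
Proof.
move=> _ _ [s [B [sW mB ->]]] [s' [B' [sW' mB' ->]]].
exists (s ++ s'), (fun i => (if i \in s then B i else setT) `&`
                            (if i \in s' then B' i else setT)).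
split.
- by move=> i; rewrite mem_cat => /orP[/sW|/sW'].
- by move=> i; apply: measurableI; case: ifP.
- apply/seteqP; split => f /=.
    by move=> [fB fB'] i _; split; case: ifP => // ?; [exact: fB|exact: fB'].
  move=> H; split => i si; have := H i; rewrite mem_cat si ?orbT/=.
    by move=> /(_ isT)[].
  by move=> /(_ isT)[].
Qed.

Lemma word_cylinderT W : word_cylinder W setT.
Proof.
exists [::], (fun=> setT); split => //.
by apply/seteqP; split.
Qed.

(** A sample point carries one angle per word. Working on this space rather than
on the original one makes passing to the subtree below a child a measurable map
of the space into itself. *)
Definition rotations : measurableType _ :=
  g_sigma_algebraType (word_cylinder setT).

Lemma measurable_word_cylinder W (A : set rotations) :
  word_cylinder W A -> measurable A.
Proof.
move=> [s [B [_ mB ->]]]; apply: sub_sigma_algebra.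
by exists s, B; split.
Qed.

Lemma measurable_rotation (i : word) :
  measurable_fun setT (fun f : rotations => f i).
Proof.
move=> _ B mB; rewrite setTI; apply: (@measurable_word_cylinder setT).
exists [:: i], (fun=> B); split => //.
apply/seteqP; split => f /=; first by move=> fB j; rewrite inE => /eqP ->.
by move=> /(_ i); apply; rewrite inE.
Qed.

Lemma measurable_rotations d (T : measurableType d) (F : T -> rotations) :
  (forall i, measurable_fun setT (fun t => F t i)) -> measurable_fun setT F.
Proof.
move=> mF; apply: (@measurability _ _ _ rotations _ _ (word_cylinder setT)) => //.
move=> _ [_ [s [B [_ mB ->]]] <-]; rewrite setTI.
have -> : F @^-1` (coordinate_set s B) =
    \bigcap_(i in [set` s]) ((fun t => F t i) @^-1` B i) by [].
apply: fin_bigcap_measurable; first exact: finite_seq.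
by move=> i _; rewrite -[X in measurable X]setTI; exact: mF.
Qed.

Definition reindex tau (f : rotations) : rotations := f \o tau.

Lemma measurable_reindex tau : measurable_fun setT (reindex tau).
Proof. by apply: measurable_rotations => i; exact: measurable_rotation. Qed.

Lemma preimage_reindex_cylinder tau (A : set rotations) :
  word_cylinder setT A -> word_cylinder (range tau) (reindex tau @^-1` A).
Proof.
move=> [s [B [_ mB ->]]].
exists (map tau s), (fun u => \bigcap_(v in [set v | v \in s /\ tau v = u]) B v).
split.
- by move=> _ /mapP[v _ ->]; exists v.
- move=> u; apply: fin_bigcap_measurable => //.
  by apply: (sub_finite_set _ (finite_seq s)) => v [].
- apply/seteqP; split => f /=.
    by move=> fB _ /mapP[v _ ->] w [ws <-]; exact: fB.
  by move=> fB i si; apply: (fB (tau i)); [exact: map_f|split].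
Qed.

Lemma coordinate_set_undup s B : coordinate_set (undup s) B = coordinate_set s B.
Proof.
by apply/seteqP; split => f fB i si; apply: fB; rewrite ?mem_undup// -mem_undup.
Qed.

Definition iid_uniform (m : probability rotations R) :=
  forall s (B : word -> set R), uniq s -> (forall i, measurable (B i)) ->
    (m (coordinate_set s B) = \prod_(i <- s) uniform_turn (B i))%E.

Section iid_uniform_theory.
Variable (m : probability rotations R).
Hypothesis m_iid : iid_uniform m.

Lemma disjoint_cylinder_independent W W' A A' : [disjoint W & W'] ->
  word_cylinder W A -> word_cylinder W' A' -> (m (A `&` A') = m A * m A')%E.
Proof.
move=> WW' [s [B [sW mB ->]]] [s' [B' [sW' mB' ->]]].
rewrite -(coordinate_set_undup s) -(coordinate_set_undup s').
have uss' : uniq (undup s ++ undup s').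
  rewrite cat_uniq !undup_uniq /= andbT; apply/hasPn => i.
  rewrite !mem_undup => /sW' W'i; apply/negP => /sW Wi.
  by have [] := (disj_setPRL WW') i W'i.
pose B'' i := if i \in s then B i else B' i.
have -> : coordinate_set (undup s) B `&` coordinate_set (undup s') B' =
    coordinate_set (undup s ++ undup s') B''.
  apply/seteqP; split => f /=.
    move=> [fB fB'] i; rewrite mem_cat /B'' !mem_undup; case: ifPn => //= si.
      by move=> _; apply: fB; rewrite mem_undup.
    by move=> ?; apply: fB'; rewrite mem_undup.
  move=> H; split => i si; have := H i; rewrite mem_cat si ?orbT /B''.
    by move: (si); rewrite mem_undup => -> /(_ isT).
  case: ifPn => [si' _|_ /(_ isT)//].
  move: uss'; rewrite cat_uniq => /and3P[_ /hasPn/(_ i si)/negP + _].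
  by rewrite mem_undup si'.
rewrite !m_iid ?undup_uniq//; last by move=> i; rewrite /B''; case: ifP.
rewrite big_cat/=; congr (_ * _)%E; apply: eq_big_seq => i.
  by rewrite mem_undup /B'' => ->.
move=> si'; rewrite /B''; case: ifPn => // si.
move: uss'; rewrite cat_uniq => /and3P[_ /hasPn/(_ i si')/negP + _].
by rewrite mem_undup si.
Qed.

(** Functions that read their angles at disjoint sets of words are independent:
by [disjoint_cylinder_independent] this holds for cylinders, and two
applications of the pi-lambda lemma extend it to all measurable sets. *)
Lemma reindex_independent tau tau' A A' :
  [disjoint range tau & range tau'] -> measurable A -> measurable A' ->
  (m (reindex tau @^-1` A `&` reindex tau' @^-1` A') =
   m (reindex tau @^-1` A) * m (reindex tau' @^-1` A'))%E.
Proof.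
move=> tautau' mA mA'.
have mpre t C : measurable C -> measurable (reindex t @^-1` C).
  by move=> mC; rewrite -[X in measurable X]setTI; exact: measurable_reindex.
apply: (@pi_lambda_independence _ _ rotations rotations R m (reindex tau')
  (word_cylinder setT) (reindex tau @^-1` A)) => //.
- exact: measurable_reindex.
- exact: word_cylinderI.
- exact: word_cylinderT.
- exact: mpre.
move=> C cC; rewrite setIC muleC.
apply: (@pi_lambda_independence _ _ rotations rotations R m (reindex tau)
  (word_cylinder setT) (reindex tau' @^-1` C)) => //.
- exact: measurable_reindex.
- exact: word_cylinderI.
- exact: word_cylinderT.
- by apply: mpre; exact: measurable_word_cylinder cC.
move=> D cD; apply: (@disjoint_cylinder_independent (range tau') (range tau)).
- by rewrite disj_set_sym.
- exact: preimage_reindex_cylinder.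
- exact: preimage_reindex_cylinder.
Qed.

(** Reading i.i.d. angles at distinct words gives i.i.d. angles with the same
law. *)
Lemma reindex_law tau A : injective tau -> measurable A ->
  m (reindex tau @^-1` A) = m A.
Proof.
move=> tau_inj mA.
pose tm : {mfun rotations >-> rotations} :=
  mfun_Sub (mem_set (measurable_reindex tau)).
rewrite -[LHS]/(distribution m tm A).
apply: (@g_sigma_algebra_measure_unique _ _ rotations (word_cylinder setT) _
  (fun=> setT) _ _ (distribution m tm) m) => //.
- by move=> C; exact: measurable_word_cylinder.
- by move=> _; exact: word_cylinderT.
- by rewrite bigcup_const//; exists 0%N.
- exact: word_cylinderI.
- move=> _ [s [B [_ mB ->]]] /=; rewrite -(coordinate_set_undup s).
  set s' := undup s; have us' : uniq s' by exact: undup_uniq.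
  pose taui u := xget [::] [set v | tau v = u].
  have tauK : cancel tau taui.
    by move=> v; apply: tau_inj; exact: (@xgetI _ [::] [set w | tau w = tau v] v).
  rewrite /distribution /pushforward.
  have -> : tm @^-1` coordinate_set s' B = coordinate_set (map tau s') (B \o taui).
    apply/seteqP; split => f /=.
      by move=> fB _ /mapP[v sv ->]; rewrite /= tauK; exact: fB.
    by move=> fB v sv; have := fB (tau v) (map_f _ sv); rewrite /= tauK.
  rewrite !m_iid ?map_inj_uniq//; last by move=> i; exact: mB.
  by rewrite big_map; apply: eq_bigr => v _ /=; rewrite tauK.
- by move=> _; rewrite (le_lt_trans (probability_le1 _ _)) ?ltry.
Qed.

Lemma integral_reindex tau (F : rotations -> \bar R) : injective tau ->
  measurable_fun setT F -> (forall f, 0 <= F f)%E ->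
  (\int[m]_f F (reindex tau f) = \int[m]_f F f)%E.
Proof.
move=> tau_inj mF F0.
pose tm : {mfun rotations >-> rotations} :=
  mfun_Sub (mem_set (measurable_reindex tau)).
rewrite -(@ge0_integral_distribution _ _ _ _ _ m tm)//.
by apply: eq_measure_integral => A mA _; exact: reindex_law.
Qed.

Definition subtree (j : 'I_4) : rotations -> rotations :=
  reindex (fun v => rcons v j).

Lemma measurable_subtree j : measurable_fun setT (subtree j).
Proof. exact: measurable_reindex. Qed.

Lemma integral_subtree j (F : rotations -> \bar R) :
  measurable_fun setT F -> (forall f, 0 <= F f)%E ->
  (\int[m]_f F (subtree j f) = \int[m]_f F f)%E.
Proof. by apply: integral_reindex => v w; exact: rcons_injl. Qed.

Lemma integral_root (F : measurableTypeR R -> \bar R) :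
  measurable_fun setT F -> (forall x, 0 <= F x)%E ->
  (\int[m]_f F (f [::]) = \int[@uniform_turn R]_x F x)%E.
Proof.
move=> mF F0.
have mroot : @measurable_fun _ _ rotations (measurableTypeR R) setT
    (fun f => f [::]).
  exact: measurable_rotation.
pose root : {mfun rotations >-> measurableTypeR R} :=
  @mfun_Sub _ _ rotations (measurableTypeR R) _ (mem_set mroot).
rewrite -(@ge0_integral_distribution _ _ _ _ _ m root)//.
apply: (@eq_measure_integral _ _ _ setT (@uniform_turn R) (distribution m root)) => A mA _.
have rootE : (fun f : rotations => f [::]) @^-1` A =
    coordinate_set [:: [::]] (fun=> A).
  apply/seteqP; split => f /=; first by move=> Af i; rewrite inE => /eqP ->.
  by move=> /(_ [::]); apply; rewrite inE.
transitivity (m (coordinate_set [:: [::]] (fun=> A))); first by rewrite -rootE.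
by rewrite m_iid// big_seq1.
Qed.

(** The subtrees below two distinct children and the angle at the root are
independent, and each subtree has the law of the whole tree. *)
Lemma integral_branches (j l : 'I_4) (F : rotations * (rotations * measurableTypeR R) -> \bar R) :
  j != l -> measurable_fun setT F -> (forall z, 0 <= F z)%E ->
  (\int[m]_f F (subtree j f, (subtree l f, f [::])) =
   \int[m]_g \int[m]_h \int[@uniform_turn R]_x F (g, (h, x)))%E.
Proof.
move=> jl mF F0.
(* Sends the words below j to the root: reading the angles through [other] loses
   the subtree of j and nothing else. *)
pose other (v : word) : word :=
  if (v != [::]) && (last j v == j) then [::] else v.
have other_disj : [disjoint range (fun v => rcons v j) & range other].
  apply/disj_setPRL => _ [v _ <-] /= [w _]; rewrite /other.
  case: ifPn => [_|vj wv]; first by case: w.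
  by move: vj; rewrite -wv last_rcons eqxx andbT; case: (w).
have subtree_other (k : 'I_4) f : j != k -> subtree k (reindex other f) = subtree k f.
  move=> jk; apply/funext => v; rewrite /subtree /reindex /= /other.
  by rewrite last_rcons (eq_sym k) (negPf jk) andbF.
pose Phi z : \bar R := F (z.1, (subtree l z.2, z.2 [::])).
have mPhi : measurable_fun setT Phi.
  apply: measurableT_comp => //; apply: measurable_fun_pair; first exact: measurable_fst.
  apply: measurable_fun_pair.
    by apply: measurableT_comp; [exact: measurable_subtree|exact: measurable_snd].
  exact: (measurableT_comp (measurable_rotation [::]) measurable_snd).
transitivity (\int[m]_f Phi (subtree j f, reindex other f))%E.
  by apply: eq_integral => f _; rewrite /Phi/= subtree_other.
have indep A B : measurable A -> measurable B ->
    (m (subtree j @^-1` A `&` reindex other @^-1` B) =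
     m (subtree j @^-1` A) * m (reindex other @^-1` B))%E.
  by move=> mA mB; exact: reindex_independent.
rewrite (integral_independent_pair (measurable_subtree j)
  (measurable_reindex other) indep mPhi); last by move=> z; exact: F0.
have mF2 : measurable_fun setT
    (fun z : rotations * rotations => \int[@uniform_turn R]_x F (z.1, (z.2, x)))%E.
  pose F' (z : (rotations * rotations) * measurableTypeR R) :=
    F (z.1.1, (z.1.2, z.2)).
  have mF' : measurable_fun setT F'; last first.
    exact: (@measurable_fun_fubini_tonelli_F _ _ _ _ _ (@uniform_turn R) F' mF'
      (fun z => F0 _)).
  apply: measurableT_comp => //; apply: measurable_fun_pair.
    by apply: measurableT_comp => //; exact: measurable_fst.
  apply: measurable_fun_pair => //.
  by apply: measurableT_comp => //; exact: measurable_fst.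
have inner g : (\int[m]_f Phi (g, f) =
    \int[m]_h \int[@uniform_turn R]_x F (g, (h, x)))%E.
  rewrite /Phi/=.
  have mg : measurable_fun setT (fun z : rotations * rotations => F (g, (z.1, z.2 [::]))).
    apply: measurableT_comp => //; apply: measurable_fun_pair => //.
    apply: measurable_fun_pair => //.
    exact: (measurableT_comp (measurable_rotation [::]) measurable_snd).
  have root_indep A B : measurable A -> measurable B ->
      (m (subtree l @^-1` A `&` reindex (fun=> [::]) @^-1` B) =
       m (subtree l @^-1` A) * m (reindex (fun=> [::]) @^-1` B))%E.
    move=> mA mB; apply: reindex_independent => //.
    by apply/disj_setPRL => _ [v _ <-] /= [w _]; case: w.
  rewrite (integral_independent_pair (measurable_subtree l)
    (measurable_reindex (fun=> [::])) root_indep mg)//=.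
  pose avg h := (\int[@uniform_turn R]_x F (g, (h, x)))%E.
  have mavg : measurable_fun setT avg.
    have mpair : measurable_fun setT (fun h : rotations => (g, h)).
      by apply: measurable_fun_pair.
    exact: (measurableT_comp mF2 mpair).
  have avg0 h : (0 <= avg h)%E by apply: integral_ge0.
  rewrite -(integral_subtree l mavg avg0).
  apply: eq_integral => h _.
  apply: (@integral_root (fun x => F (g, (subtree l h, x)))) => [|x]; last exact: F0.
  by apply: measurableT_comp mF _; apply: measurable_fun_pair.
transitivity (\int[m]_g \int[m]_h \int[@uniform_turn R]_x F (subtree j g, (h, x)))%E.
  apply: eq_integral => g _; rewrite -inner; apply: eq_integral => f _.
  by rewrite /Phi/= subtree_other.
apply: (@integral_subtree j (fun g => \int[m]_h \int[@uniform_turn R]_x F (g, (h, x)))%E).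
- apply: (@measurable_fun_fubini_tonelli_F _ _ _ _ _ m
    (fun z : rotations * rotations => \int[@uniform_turn R]_x F (z.1, (z.2, x)))%E) => //.
  by move=> z; apply: integral_ge0.
- by move=> g; apply: integral_ge0 => h _; apply: integral_ge0.
Qed.
End iid_uniform_theory.
End rotation_space.

(** * Measures of unions and of sections *)

Section measure_lemmas.
Context d (T : measurableType d) (R : realType).
Variable m : {measure set T -> \bar R}.
Local Open Scope ereal_scope.

(** The integral of a nonnegative function is a supremum over the simple
functions below it, so it is monotone even for functions that are not known to
be measurable, such as the projections of the random set. *)
Lemma le_ge0_integral (D : set T) (f g : T -> \bar R) :
  (forall x, D x -> 0 <= f x) -> (forall x, D x -> f x <= g x) ->
  \int[m]_(x in D) f x <= \int[m]_(x in D) g x.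
Proof.
move=> f0 fg.
have g0 x : D x -> 0 <= g x by move=> Dx; rewrite (le_trans (f0 _ Dx)) ?fg.
rewrite !ge0_integralE//; apply: ereal_sup_le => _ [h hf <-]; exists h => // x.
rewrite (le_trans (hf x))// !patchE; case: ifPn => // /set_mem; exact: fg.
Qed.

Lemma measureUI (A B : set T) : measurable A -> measurable B ->
  m (A `|` B) + m (A `&` B) = m A + m B.
Proof.
move=> mA mB.
rewrite (_ : A `|` B = (A `\` B) `|` B); last first.
  by apply/seteqP; split => x /=; have [] := pselect (B x); tauto.
rewrite measureU//; last 2 first.
- exact: measurableD.
- by apply/seteqP; split => x //= -[[]].
by rewrite addeAC; congr (_ + _); rewrite -measureDI.
Qed.

(** Used to bound the length of a union of four sets from above while keeping
the overlaps of only two disjoint pairs. *)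
Lemma le_measureUI_pair (A B C D : set T) : measurable A -> measurable B ->
  measurable C -> measurable D ->
  m ((A `|` C) `|` (B `|` D)) + (m (A `&` C) + m (B `&` D)) <=
  (m A + m C) + (m B + m D).
Proof.
move=> mA mB mC mD; rewrite -(measureUI mA mC) -(measureUI mB mD).
rewrite [leRHS]addeACA leeD2r// -measureUI; try exact: measurableU.
by rewrite leeDl.
Qed.

Lemma bonferroni_lower (A : nat -> set T) n : (forall k, measurable (A k)) ->
  \sum_(j < n) m (A j) <= m (\big[setU/set0]_(j < n) A j) +
    \sum_(j < n) \sum_(l < j) m (A l `&` A j).
Proof.
move=> mA; elim: n => [|n IH]; first by rewrite !big_ord0 measure0 adde0.
rewrite !big_ord_recr/=.
have mU : measurable (\big[setU/set0]_(j < n) A j) by rewrite -bigcup_mkord; apply: bigcup_measurable => k _; exact: mA.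
apply: (@le_trans _ _ (m (\big[setU/set0]_(j < n) A j) +
    \sum_(j < n) \sum_(l < j) m (A l `&` A j) + m (A n))).
  by rewrite leeD2r.
rewrite addeAC -measureUI// -!addeA leeD2l// addeC leeD2l//.
rewrite big_distrl/=; apply: (Boole_inequality m (A := fun l => A l `&` A n)) => i _.
exact: measurableI.
Qed.

End measure_lemmas.

Section section_measure.
Context d (T : measurableType d) (R : realType).
Variable Phi : T -> set R.
Hypothesis mPhi :
  measurable ([set z | Phi z.1 z.2] : set (T * measurableTypeR R)).

Lemma measurable_of_graph t : measurable (Phi t).
Proof.
have := measurable_xsection t mPhi; congr (measurable _).
by apply/seteqP; split => x /=; rewrite /xsection/= inE.
Qed.

Lemma measurable_fun_measure_graph :
  measurable_fun setT (fun t => @lebesgue_measure R (Phi t)).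
Proof.
have := measurable_fun_xsection (@lebesgue_measure R) mPhi.
apply: eq_measurable_fun => t _ /=; congr lebesgue_measure.
by apply/seteqP; split => x /=; rewrite /xsection/= inE.
Qed.

End section_measure.

(** * Shadows *)

Section shadow.
Context {R : realType}.
Local Notation Rot := (@rotations R).
Local Notation mu := (@lebesgue_measure R).
Implicit Types (theta x : R) (n k : nat) (r : nat -> R) (f : Rot).

(** The projection to the line of direction theta of the discs of generation n,
for a tree rooted at the origin. The recursion is on the children of the root:
each child contributes the shadow of its own subtree, for the shifted sequence
of radii, translated by the projection of its center. Compare [shadowP]. *)
Fixpoint shadow theta n r (f : Rot) : set R :=
  if n is n'.+1 then
    [set x | exists j : 'I_4, shadow theta n' (r \o S) (subtree j f)
       (x - (r 0%N - r 1%N) * cos (f [::] + 2 * pi * j%:R / 4 - theta))]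
  else [set x | `|x| <= r 0%N].

Arguments shadow theta n r f : simpl never.

Definition branch_shadow theta n r f k : set R :=
  [set x | shadow theta n (r \o S) (subtree (inord k) f)
       (x - (r 0%N - r 1%N) * cos (f [::] + 2 * pi * k%:R / 4 - theta))].

Lemma shadowS theta n r f :
  shadow theta n.+1 r f = \big[setU/set0]_(k < 4) branch_shadow theta n r f k.
Proof.
rewrite -bigcup_mkord; apply/seteqP; split => x /=.
  by move=> [j xj]; exists j => /=; rewrite ?/branch_shadow/= ?inord_val.
move=> [k /= k4]; rewrite /branch_shadow /= => xk; exists (inord k).
by rewrite inordK.
Qed.

Local Notation RR := (measurableTypeR R).

Lemma measurable_branch_of_shadow n r k :
  (forall r', measurable ([set z | shadow z.1.1 n r' z.1.2 z.2] :
    set ((RR * Rot) * RR))) ->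
  measurable ([set z | branch_shadow z.1.1 n r z.1.2 k z.2] :
    set ((RR * Rot) * RR)).
Proof.
move=> IH.
pose F (z : (RR * Rot) * RR) : (RR * Rot) * RR :=
  ((z.1.1, subtree (inord k) z.1.2),
   z.2 - (r 0%N - r 1%N) * cos (z.1.2 [::] + 2 * pi * k%:R / 4 - z.1.1)).
have mF : measurable_fun setT F.
  have m11 : measurable_fun setT (fun z : (RR * Rot) * RR => z.1.1 : R).
    exact: (measurableT_comp measurable_fst measurable_fst).
  have m12 : measurable_fun setT (fun z : (RR * Rot) * RR => z.1.2).
    exact: (measurableT_comp measurable_snd measurable_fst).
  have m2 : measurable_fun setT (fun z : (RR * Rot) * RR => z.2 : R).
    exact: measurable_snd.
  have m0 : measurable_fun setT (fun z : (RR * Rot) * RR => z.1.2 [::] : R).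
    exact: (measurableT_comp (measurable_rotation [::]) m12).
  have m3 : measurable_fun setT (fun z : (RR * Rot) * RR =>
      z.2 - (r 0%N - r 1%N) * cos (z.1.2 [::] + 2 * pi * k%:R / 4 - z.1.1) : R).
    apply: measurable_funB => //; apply: measurable_funM => //.
    apply: measurableT_comp.
      by apply: continuous_measurable_fun; exact: continuous_cos.
    by apply: measurable_funB => //; apply: measurable_funD.
  apply: measurable_fun_pair; last exact: m3.
  apply: measurable_fun_pair; first exact: m11.
  by apply: measurableT_comp; [exact: measurable_subtree|exact: m12].
by rewrite -[X in measurable X]setTI; exact: (mF measurableT _ (IH (r \o S))).
Qed.

(** Joint measurability in the direction, the rotations and the point of the
line; all measurability facts about shadows are sections of this one. *)
Lemma measurable_shadow_graph n r :
  measurable ([set z | shadow z.1.1 n r z.1.2 z.2] : set ((RR * Rot) * RR)).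
Proof.
elim: n => [|n IH] in r *.
  have mn : measurable_fun setT (fun z : (RR * Rot) * RR => `|z.2| : R).
    apply: measurableT_comp => //; exact: measurable_snd.
  rewrite -[X in measurable X]setTI.
  rewrite (_ : [set _ | _] = (fun z : (RR * Rot) * RR => `|z.2|) @^-1`
      [set` `]-oo, r 0%N]]); first exact: mn.
  by apply/seteqP; split => z /=; rewrite in_itv.
rewrite (_ : [set _ | _] = \bigcup_(k in `I_4)
    [set z | branch_shadow z.1.1 n r z.1.2 k z.2]).
  apply: bigcup_measurable => k _; exact: measurable_branch_of_shadow.
apply/seteqP; split => z.
  by rewrite /= shadowS -bigcup_mkord => -[k k4 zk]; exists k.
by move=> [k k4 zk] /=; rewrite shadowS -bigcup_mkord; exists k.
Qed.

Lemma measurable_branch_graph n r k :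
  measurable ([set z | branch_shadow z.1.1 n r z.1.2 k z.2] :
    set ((RR * Rot) * RR)).
Proof. by apply: measurable_branch_of_shadow => r'; exact: measurable_shadow_graph. Qed.

Lemma measurable_at_angle (Phi : R -> Rot -> set R) theta :
  measurable ([set z | Phi z.1.1 z.1.2 z.2] : set ((RR * Rot) * RR)) ->
  measurable ([set z | Phi theta z.1 z.2] : set (Rot * RR)).
Proof.
move=> mPhi.
have mF : measurable_fun setT (fun z : Rot * RR => (((theta : RR), z.1), z.2)).
  by apply: measurable_fun_pair => //; apply: measurable_fun_pair.
by rewrite -[X in measurable X]setTI; exact: (mF measurableT _ mPhi).
Qed.

Let measurable_shadow_at theta n r :
  measurable ([set z | shadow theta n r z.1 z.2] : set (Rot * RR)).
Proof.
exact: (@measurable_at_angle (fun th f => shadow th n r f) theta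
  (measurable_shadow_graph n r)).
Qed.

Let measurable_branch_at theta n r k :
  measurable ([set z | branch_shadow theta n r z.1 k z.2] : set (Rot * RR)).
Proof.
exact: (@measurable_at_angle (fun th f => branch_shadow th n r f k) theta
  (measurable_branch_graph n r k)).
Qed.

Lemma measurable_shadow theta n r f : measurable (shadow theta n r f).
Proof. exact: (measurable_of_graph (measurable_shadow_at theta n r) f). Qed.

Lemma measurable_branch_shadow theta n r f k :
  measurable (branch_shadow theta n r f k).
Proof.
exact: (@measurable_of_graph _ _ _ (fun f => branch_shadow theta n r f k)
  (measurable_branch_at theta n r k)).
Qed.

Lemma measurable_fun_shadow theta n r :
  measurable_fun setT (fun f => mu (shadow theta n r f)).
Proof.
exact: (@measurable_fun_measure_graph _ _ _ (shadow theta n r)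
  (measurable_shadow_at theta n r)).
Qed.

Lemma measurable_fun_branch_shadow theta n r k :
  measurable_fun setT (fun f => mu (branch_shadow theta n r f k)).
Proof.
exact: (@measurable_fun_measure_graph _ _ _
  (fun f => branch_shadow theta n r f k) (measurable_branch_at theta n r k)).
Qed.

Lemma measurable_fun_branch_overlap theta n r k l : measurable_fun setT
  (fun f => mu (branch_shadow theta n r f k `&` branch_shadow theta n r f l)).
Proof.
apply: (@measurable_fun_measure_graph _ _ _
  (fun f => branch_shadow theta n r f k `&` branch_shadow theta n r f l)).
exact: (measurableI _ _ (measurable_branch_at theta n r k)
  (measurable_branch_at theta n r l)).
Qed.

(** Only the radii of generations 0 to n enter a shadow of generation n. The
truncated radii used below are constant from generation n on, so the ratio of
consecutive radii can be controlled only up to there. *)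
Definition lacunary n r := 0 < r n /\ forall k, (k < n)%N -> 3 * r k.+1 <= r k.

Lemma lacunaryS n r : lacunary n.+1 r -> lacunary n (r \o S).
Proof. by move=> [rn rS]; split => // k kn; exact: rS. Qed.

Lemma lacunary_gt0 n r k : (k <= n)%N -> lacunary n r -> 0 < r k.
Proof.
elim: n => [|n IH] in r k *; first by rewrite leqn0 => /eqP -> [].
case: k => [_|k kn] lr; last exact: (IH (r \o S) k kn (lacunaryS lr)).
have := IH (r \o S) 0%N (leq0n _) (lacunaryS lr).
by have := lr.2 0%N (ltn0Sn _); rewrite /=; lra.
Qed.

Lemma shadow_bounded theta n r f : lacunary n r ->
  shadow theta n r f `<=` `[- r 0%N, r 0%N].
Proof.
elim: n => [|n IH] in r f *.
  by move=> _ x; rewrite /shadow/= in_itv/= ler_norml.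
move=> lr x [j /(IH _ _ (lacunaryS lr))]; rewrite /= !in_itv/=.
have r1 := lacunary_gt0 (isT : (1 <= n.+1)%N) lr.
have r01 := lr.2 0%N isT.
set c := cos _; have c1 : c <= 1 by exact: cos_le1.
have c2 : -1 <= c by exact: cos_geN1.
move=> /andP[x1 x2]; apply/andP; split; nra.
Qed.

Lemma shadow_measure_le theta n r f : lacunary n r ->
  (mu (shadow theta n r f) <= (2 * r 0%N)%:E)%E.
Proof.
move=> lr.
have H := le_lebesgue_measure (@shadow_bounded theta n r f lr).
apply: (le_trans H).
rewrite lebesgue_measure_itv/= lte_fin; case: ifPn => _.
  by rewrite -EFinD lee_fin; lra.
by rewrite lee_fin mulr_ge0// ltW// (lacunary_gt0 (leq0n n)).
Qed.

End shadow.

(** * Differences of cosines *)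

Section trigonometry.
Context {R : realType}.
Implicit Types (A D : R).

Lemma cos_difference A D :
  cos (A - D) - cos (A + D) = 2 * sin D * cos (A + 3 * pi / 2).
Proof.
have -> : A + 3 * pi / 2 = (A + pi) + pi / 2 by field.
by rewrite cosDpihalf sinDpi cosB cosD; ring.
Qed.

(** The angle is pi/4, pi/2 or 3 pi/4, so its double has nonpositive cosine. *)
Lemma sin_quarter_turns d : (0 < d < 4)%N ->
  0 < sin (d%:R * pi / 4 : R) /\ 1 / 2 <= sin (d%:R * pi / 4 : R) ^+ 2.
Proof.
move=> /andP[d0 d4].
set D := d%:R * pi / 4.
have p0 := pi_gt0 R.
have s0 : 0 < sin D.
  apply: sin_gt0_pi; rewrite /D; apply/andP; split.
    by rewrite !mulr_gt0// ltr0n.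
  by rewrite ltr_pdivrMr// mulrC ltr_pM2l// ltr_nat.
have c0 : cos (D *+ 2) <= 0.
  have -> : D *+ 2 = d%:R * pi / 2 by rewrite /D mulr2n; field.
  case: d d0 d4 {D s0} => [|[|[|[|]]]]// _ _.
  - by rewrite mul1r cos_pihalf.
  - have -> : 2%:R * pi / 2 = pi :> R by field.
    by rewrite cospi oppr_le0.
  - have -> : 3%:R * pi / 2 = pi / 2 + pi :> R by field.
    by rewrite cosDpi cos_pihalf oppr0.
rewrite cos_mulr2n in c0; have := cos2Dsin2 D; rewrite mulr2n in c0.
by split => //; lra.
Qed.

Lemma sin_two_quarter_turns : sin (2%:R * pi / 4 : R) = 1.
Proof. by rewrite (_ : 2%:R * pi / 4 = pi / 2) ?sin_pihalf//; field. Qed.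

Lemma pi_lt4 : pi < 4 :> R.
Proof. by have := pihalf_lt2 R; lra. Qed.

End trigonometry.

(** * Expected length of a shadow *)

Section mean_shadow.
Context {R : realType}.
Local Notation Rot := (@rotations R).
Local Notation RR := (measurableTypeR R).
Local Notation mu := (@lebesgue_measure R).
Variable m : probability Rot R.
Hypothesis m_iid : iid_uniform m.
Implicit Types (theta : R) (n k l : nat) (r : nat -> R) (f : Rot).

Definition mean_shadow theta n r : R :=
  fine (\int[m]_f mu (shadow theta n r f)).

Lemma mean_shadow_int_le theta n r : lacunary n r ->
  (\int[m]_f mu (shadow theta n r f) <= (2 * r 0%N)%:E)%E.
Proof.
move=> lr; apply: (@le_trans _ _ (\int[m]_f cst (2 * r 0%N)%:E f)%E).
  by apply: le_ge0_integral => // f _; exact: shadow_measure_le.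
rewrite integral_cst// [X in (_ * X)%E](_ : _ = 1%E) ?mule1//.
exact: probability_setT.
Qed.

Lemma mean_shadowE theta n r : lacunary n r ->
  (\int[m]_f mu (shadow theta n r f) = (mean_shadow theta n r)%:E)%E.
Proof.
move=> lr; rewrite fineK// ge0_fin_numE.
  by rewrite (le_lt_trans (mean_shadow_int_le _ lr))// ltry.
by apply: integral_ge0.
Qed.

Lemma mean_shadow_ge0 theta n r : 0 <= mean_shadow theta n r.
Proof. by rewrite fine_ge0// integral_ge0. Qed.

Lemma mean_shadow_le theta n r : lacunary n r ->
  mean_shadow theta n r <= 2 * r 0%N.
Proof. by move=> lr; rewrite -lee_fin -mean_shadowE// mean_shadow_int_le. Qed.

Lemma mean_branch_shadow theta n r k :
  (\int[m]_f mu (branch_shadow theta n r f k) =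
   \int[m]_f mu (shadow theta n (r \o S) f))%E.
Proof.
rewrite -(integral_subtree m_iid (inord k) (measurable_fun_shadow theta n (r \o S)))//.
apply: eq_integral => f _.
exact: (lebesgue_measure_translate _ (measurable_shadow theta n (r \o S) (subtree (inord k) f))).
Qed.

Let shadow_overlap theta n r (a b : R) (z : Rot * (Rot * RR)) : set R :=
  [set y | shadow theta n r z.1 y /\
           shadow theta n r z.2.1 (y + a * cos (z.2.2 + b))].

Let measurable_shadow_overlap theta n r a b :
  measurable_fun setT (fun z => mu (shadow_overlap theta n r a b z)).
Proof.
apply: (@measurable_fun_measure_graph _ _ _ (shadow_overlap theta n r a b)).
have mG := @measurable_at_angle R (fun th f => shadow th n r f) theta
  (measurable_shadow_graph n r).
pose Z := ((Rot * (Rot * RR)) * RR)%type.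
have m1 : measurable_fun setT (fun z : Z => (z.1.1, z.2)).
  apply: measurable_fun_pair; last exact: measurable_snd.
  exact: (measurableT_comp measurable_fst measurable_fst).
have m2 : measurable_fun setT (fun z : Z => (z.1.2.1, (z.2 + a * cos (z.1.2.2 + b) : RR))).
  have m12 : measurable_fun setT (fun z : Z => z.1.2).
    exact: (measurableT_comp measurable_snd measurable_fst).
  apply: measurable_fun_pair.
    exact: (measurableT_comp measurable_fst m12).
  have m3 : measurable_fun setT (fun z : Z => z.1.2.2 : R).
    exact: (measurableT_comp measurable_snd m12).
  have m4 : measurable_fun setT (fun z : Z => z.2 : R).
    exact: measurable_snd.
  have : measurable_fun setT (fun z : Z => z.2 + a * cos (z.1.2.2 + b) : R).
    apply: measurable_funD => //; apply: measurable_funM => //.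
    apply: measurableT_comp.
      by apply: continuous_measurable_fun; exact: continuous_cos.
    by apply: measurable_funD.
  exact.
apply: measurableI.
  by rewrite -[X in measurable X]setTI; exact: (m1 measurableT _ mG).
by rewrite -[X in measurable X]setTI; exact: (m2 measurableT _ mG).
Qed.

(* Amplitude and phase of the relative shift of the children k < l. *)
Let gap r k l : R := 2 * (r 0%N - r 1%N) * sin ((l - k)%N%:R * pi / 4).
Let phase theta k l : R := (k + l)%N%:R * pi / 4 - theta + 3 * pi / 2.

(** After translating one of the two pieces back to the origin, the other is
shifted by a difference of two cosines of the same random angle, which is a
multiple of a single cosine by [cos_difference]. *)
Lemma mean_branch_overlap theta n r k l : (k < l < 4)%N ->
  (\int[m]_f mu (branch_shadow theta n r f k `&` branch_shadow theta n r f l) =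
   \int[m]_g \int[m]_h \int[uniform_turn]_x
     mu [set y | shadow theta n (r \o S) g y /\
       shadow theta n (r \o S) h (y + gap r k l * cos (x + phase theta k l))%R])%E.
Proof.
move=> /andP[kl l4].
have kl' : inord k != inord l :> 'I_4.
  by rewrite -val_eqE /= !inordK// ?(ltn_trans kl)// neq_ltn kl.
rewrite -(@integral_branches _ _ m_iid _ _
  (fun z => mu (shadow_overlap theta n (r \o S) (gap r k l) (phase theta k l) z)) kl')//.
apply: eq_integral => f _.
set c := (r 0%N - r 1%N) * cos (f [::] + 2 * pi * k%:R / 4 - theta).
set B := shadow_overlap _ _ _ _ _ _.
have mB : measurable B.
  have mf : measurable_fun setT
      (fun y : R => y + gap r k l * cos (f [::] + phase theta k l)).
    exact: measurable_funD.
  apply: measurableI; first exact: measurable_shadow.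
  rewrite -[X in measurable X]setTI; apply: mf => //.
  exact: measurable_shadow.
rewrite -(lebesgue_measure_translate c mB); congr (mu _).
have e : (r 0%N - r 1%N) * cos (f [::] + 2 * pi * l%:R / 4 - theta) =
    c - gap r k l * cos (f [::] + phase theta k l).
  pose A := f [::] + (k + l)%N%:R * pi / 4 - theta.
  pose D : R := (l - k)%N%:R * pi / 4.
  have eA : f [::] + phase theta k l = A + 3 * pi / 2.
    rewrite /phase /A; move: (f [::]) ((k + l)%N%:R * pi / 4) (3 * pi / 2) => w u v.
    by ring.
  have eqD (w p K L t : R) :
    (w + 2 * p * K / 4 - t = w + (K + L) * p / 4 - t - (L - K) * p / 4) *
    (w + 2 * p * L / 4 - t = w + (K + L) * p / 4 - t + (L - K) * p / 4).
    by split; field.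
  have eD : f [::] + 2 * pi * k%:R / 4 - theta = A - D.
    by rewrite /A /D natrD natrB ?(ltnW kl)// (eqD _ _ _ l%:R).
  have eD' : f [::] + 2 * pi * l%:R / 4 - theta = A + D.
    by rewrite /A /D natrD natrB ?(ltnW kl)// (eqD _ _ k%:R).
  rewrite /c eA eD eD' /gap -/D.
  have := cos_difference A D; move: (cos (A - D)) (cos (A + D)) => u v.
  by move=> /(canRL (subrK _)) ->; ring.
have ex x : x - (c - gap r k l * cos (f [::] + phase theta k l)) =
    x - c + gap r k l * cos (f [::] + phase theta k l) by ring.
by apply/seteqP; split => x; rewrite /branch_shadow /B /shadow_overlap /= e ex.
Qed.

Lemma integral_shadow_product theta n r (c : R) : 0 <= c -> lacunary n r ->
  (\int[m]_g \int[m]_h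
     (c%:E * (mu (shadow theta n r g) * mu (shadow theta n r h))) =
   (c * mean_shadow theta n r ^+ 2)%:E)%E.
Proof.
move=> c0 lr; have mS := measurable_fun_shadow theta n r.
have q0 := mean_shadow_ge0 theta n r.
transitivity (\int[m]_g ((c * mean_shadow theta n r)%:E * mu (shadow theta n r g)))%E.
  apply: eq_integral => g _; rewrite ge0_integralZl//; last 2 first.
  - exact: measurable_funeM.
  - by move=> h _; exact: mule_ge0.
  by rewrite ge0_integralZl// mean_shadowE// EFinM -muleA (muleC (mean_shadow _ _ _)%:E).
rewrite ge0_integralZl// ?mean_shadowE// ?lee_fin ?mulr_ge0//.
by rewrite -EFinM mulrA.
Qed.

Section step.
Variables (theta : R) (n : nat) (r : nat -> R).
Hypotheses (theta_pi : 0 <= theta <= pi) (lr : lacunary n.+1 r).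
Let q := mean_shadow theta n (r \o S).

Let r1_gt0 : 0 < r 1%N. Proof. exact: lacunary_gt0 lr. Qed.
Let r1_le : 3 * r 1%N <= r 0%N. Proof. exact: lr.2. Qed.
Let r0_gt0 : 0 < r 0%N. Proof. by move: r1_gt0 r1_le; lra. Qed.

Let phase_ge0 k l : 0 <= phase theta k l.
Proof.
rewrite /phase; have p0 := pi_gt0 R.
have : 0 <= (k + l)%N%:R * pi / 4 :> R by rewrite !mulr_ge0// ltW.
move: (_ / 4) => u; move/andP: theta_pi => []; lra.
Qed.

Let phase_le k l : (k < l < 4)%N -> phase theta k l <= 3%:R * pi.
Proof.
move=> /andP[kl l4]; rewrite /phase; have p0 := pi_gt0 R.
have : (k + l)%N%:R <= 5%:R :> R.
  by rewrite ler_nat; lia.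
move=> /(ler_wpM2r (ltW p0)); move/andP: theta_pi => []; lra.
Qed.

(** Opposite children: the relative shift ranges over [- 2 R, 2 R] with R = r_0
- r_1 >= 2 r_1, which contains all differences of points of the two pieces. *)
Lemma mean_branch_overlap_lower k : (k < 2)%N ->
  ((q ^+ 2 / (32 * r 0%N))%:E <=
   \int[m]_f mu (branch_shadow theta n r f k `&` branch_shadow theta n r f k.+2))%E.
Proof.
move=> k2; have kk : (k < k.+2 < 4)%N by lia.
rewrite mean_branch_overlap//.
have gapE : gap r k k.+2 = 2 * (r 0%N - r 1%N).
  by rewrite /gap (_ : (k.+2 - k)%N = 2%N) ?sin_two_quarter_turns ?mulr1//; lia.
have gap0 : 0 < gap r k k.+2 by rewrite gapE; move: r1_gt0 r1_le; lra.
have p4 := @pi_lt4 R; have p0 := pi_gt0 R.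
have c0 : 0 < 4 * pi * gap r k k.+2 by rewrite mulr_gt0// mulr_gt0.
apply: (@le_trans _ _ ((4 * pi * gap r k k.+2)^-1 * q ^+ 2)%:E).
  rewrite lee_fin mulrC ler_wpM2r ?exprn_ge0 ?mean_shadow_ge0//.
  rewrite lef_pV2 ?posrE//; last by rewrite mulr_gt0.
  rewrite gapE.
  have R0 : 0 <= r 0%N - r 1%N by move: r1_gt0 r1_le; lra.
  have := ler_wpM2r R0 (ltW p4); move: r1_gt0; lra.
rewrite -(integral_shadow_product _ _ (lacunaryS lr)) ?invr_ge0 ?(ltW c0)//.
apply: le_ge0_integral => g _.
  by apply: integral_ge0 => h _; rewrite !mule_ge0// lee_fin invr_ge0 ltW.
apply: le_ge0_integral => h _.
  by rewrite !mule_ge0// lee_fin invr_ge0 ltW.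
rewrite lee_pdivrMl//; apply: (@overlap_lower _ _ _ _ _ _ _ _ _ (r 1%N)) => //.
- exact: measurable_shadow.
- exact: measurable_shadow.
- exact: shadow_bounded (lacunaryS lr).
- exact: shadow_bounded (lacunaryS lr).
by rewrite gapE; move: r1_gt0 r1_le; lra.
Qed.

(** Any two children: the amplitude a of the relative shift satisfies a^2 >= 2
(r_0 - r_1)^2 >= 8 r_1^2, so the relevant shifts stay away from the extreme
values of the cosine. *)
Lemma mean_branch_overlap_upper k l : (k < l < 4)%N ->
  (\int[m]_f mu (branch_shadow theta n r f k `&` branch_shadow theta n r f l) <=
   (15 / 2 * q ^+ 2 / r 0%N)%:E)%E.
Proof.
move=> kl4; rewrite mean_branch_overlap//.
have p2 := pi_ge2 R; have p0 := pi_gt0 R.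
have R2 : 2 * r 1%N <= r 0%N - r 1%N by move: r1_gt0 r1_le; lra.
have R0 : 0 < r 0%N - r 1%N by move: r1_gt0 r1_le; lra.
have [s1 s2] : r 0%N - r 1%N <= gap r k l /\ 8 * r 1%N ^+ 2 <= gap r k l ^+ 2.
  have /andP[kl l4] := kl4; rewrite /gap.
  have /(@sin_quarter_turns R) : (0 < l - k < 4)%N.
    by rewrite subn_gt0 kl (leq_ltn_trans (leq_subr _ _)).
  have := sin_le1 ((l - k)%N%:R * pi / 4 : R).
  move: (sin _) => s s1 [s0 ss]; move: r1_gt0 R2 R0.
  move: (r 0%N - r 1%N) => D; move: (r 1%N) => x x0 xD D0.
  have s12 : 1 / 2 <= s by nra.
  split; first by nra.
  have : (2 * x) ^+ 2 <= D ^+ 2 by nra.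
  move=> xD2; rewrite exprMn; nra.
have gap0 : 0 < gap r k l by lra.
apply: (@le_trans _ _ ((2 * 5%:R / (pi * gap r k l)) * q ^+ 2)%:E); last first.
  rewrite lee_fin (mulrAC (15 / 2)) ler_wpM2r ?exprn_ge0 ?mean_shadow_ge0//.
  rewrite ler_pdivrMr; last by rewrite mulr_gt0.
  rewrite [leRHS]mulrAC ler_pdivlMr//.
  have : 2 * (r 0%N - r 1%N) <= pi * gap r k l by rewrite ler_pM// ?ltW.
  by move: r1_le; lra.
have c0 : 0 <= 2 * 5%:R / (pi * gap r k l) by rewrite divr_ge0// mulr_ge0// ltW.
rewrite -(integral_shadow_product _ c0 (lacunaryS lr)).
apply: le_ge0_integral => g _; first by apply: integral_ge0 => h _; exact: integral_ge0.
apply: le_ge0_integral => h _; first exact: integral_ge0.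
apply: (@overlap_upper _ _ _ _ _ _ _ _ _ (r 1%N)) => //.
- exact: measurable_shadow.
- exact: measurable_shadow.
- exact: shadow_bounded (lacunaryS lr).
- exact: shadow_bounded (lacunaryS lr).
exact: phase_le.
Qed.

(** The upper bound keeps the overlaps of the two pairs of opposite children;
the lower bound is a Bonferroni inequality over all six pairs. *)
Lemma mean_shadow_step : let q' := mean_shadow theta n.+1 r in
  [/\ q <= q', q' <= 4 * q - q ^+ 2 / (16 * r 0%N) &
      4 * q - 45 * q ^+ 2 / r 0%N <= q'].
Proof.
move=> q'.
have q'E := mean_shadowE theta lr.
have qE k : (\int[m]_f mu (branch_shadow theta n r f k) = q%:E)%E.
  by rewrite mean_branch_shadow mean_shadowE//; exact: lacunaryS lr.
have mB := measurable_branch_shadow theta n r.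
have mmB := measurable_fun_branch_shadow theta n r.
have mmO := measurable_fun_branch_overlap theta n r.
have mmS := measurable_fun_shadow theta n.+1 r.
split.
- rewrite -lee_fin -(qE 0%N) -q'E; apply: le_ge0_integral => // f _.
  by apply: le_lebesgue_measure; rewrite shadowS !big_ord_recl; exact: subsetUl.
- have : (\int[m]_f (mu (shadow theta n.+1 r f) +
      (mu (branch_shadow theta n r f 0 `&` branch_shadow theta n r f 2) +
       mu (branch_shadow theta n r f 1 `&` branch_shadow theta n r f 3))) <=
      \int[m]_f ((mu (branch_shadow theta n r f 0) + mu (branch_shadow theta n r f 2)) +
        (mu (branch_shadow theta n r f 1) + mu (branch_shadow theta n r f 3))))%E.
    apply: le_ge0_integral => [f _|f _]; first by rewrite !adde_ge0.
    have -> : shadow theta n.+1 r f =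
        (branch_shadow theta n r f 0 `|` branch_shadow theta n r f 2) `|`
        (branch_shadow theta n r f 1 `|` branch_shadow theta n r f 3).
      by rewrite shadowS !big_ord_recl big_ord0 setU0/= -!setUA; congr (_ `|` _);
        rewrite setUCA.
    by apply: (le_measureUI_pair mu); exact: mB.
  do 5 (rewrite ge0_integralD//; try by [move=> f _; rewrite !adde_ge0|
    repeat apply: emeasurable_funD]).
  rewrite !qE q'E => H.
  have := le_trans (leeD2l _ (leeD (mean_branch_overlap_lower (isT : (0 < 2)%N))
     (mean_branch_overlap_lower (isT : (1 < 2)%N)))) H.
  rewrite -!EFinD lee_fin -/q -/q' => {}H.
  have -> : q ^+ 2 / (16 * r 0%N) = q ^+ 2 / (32 * r 0%N) + q ^+ 2 / (32 * r 0%N).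
    by field; rewrite gt_eqF.
  lra.
- have : (\int[m]_f (\sum_(j < 4) mu (branch_shadow theta n r f j)) <=
      \int[m]_f (mu (shadow theta n.+1 r f) + \sum_(j < 4) \sum_(l < j)
        mu (branch_shadow theta n r f l `&` branch_shadow theta n r f j)))%E.
    apply: le_ge0_integral => [f _|f _]; first by rewrite sume_ge0.
    by rewrite shadowS; apply: (bonferroni_lower mu); exact: mB.
  rewrite ge0_integral_sum// ge0_integralD//; last 2 first.
  - by move=> f _; rewrite sume_ge0// => j _; rewrite sume_ge0.
  - by apply: emeasurable_sum => j; exact: emeasurable_sum.
  rewrite ge0_integral_sum//; last 2 first.
  - by move=> j; exact: emeasurable_sum.
  - by move=> j f _; rewrite sume_ge0.
  rewrite q'E => H.
  have {}H : (\sum_(j < 4) q%:E <= q'%:E +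
      \sum_(j < 4) \sum_(l < j) (15 / 2 * q ^+ 2 / r 0%N)%:E)%E.
    apply: (le_trans _ (le_trans H _)); first by apply: lee_sum => j _; rewrite qE.
    rewrite leeD2l//; apply: lee_sum => j _; rewrite ge0_integral_sum//.
    by apply: lee_sum => l _; apply: mean_branch_overlap_upper; rewrite ltn_ord/=.
  move: H; rewrite !big_ord_recr !big_ord0/= -!EFinD lee_fin.
  have -> : 45 * q ^+ 2 / r 0%N = 6 * (15 / 2 * q ^+ 2 / r 0%N) by field; rewrite gt_eqF.
  lra.
Qed.

End step.

(** Up to constants, this is the energy of the uniform measure on the discs of
generation n for the kernel 1 / |x - y|. *)
Definition energy n r : R := \sum_(k < n.+1) (4 ^+ k * r k)^-1.

Lemma energyS n r : energy n.+1 r = (r 0%N)^-1 + energy n (r \o S) / 4.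
Proof.
rewrite /energy big_ord_recl expr0 mul1r; congr (_ + _).
rewrite big_distrl/=; apply: eq_bigr => k _.
by rewrite /= exprS !invfM; ring.
Qed.

(** By induction on n: [mean_shadow_step] says that, up to constants, the
inverse of the mean length satisfies the recursion [energyS]. *)
Lemma mean_shadow_energy theta n r : 0 <= theta <= pi -> lacunary n r ->
  1 / 15 <= mean_shadow theta n r * energy n r <= 256.
Proof.
move=> tpi; elim: n => [|n IH] in r * => lr.
  have r0 : 0 < r 0%N := lr.1.
  have -> : mean_shadow theta 0 r = 2 * r 0%N.
    rewrite /mean_shadow (eq_integral (cst (2 * r 0%N)%:E)).
      rewrite integral_cst// [X in (_ * X)%E](_ : _ = 1%E) ?mule1//.
      exact: probability_setT.
    move=> f _; rewrite (_ : shadow _ _ _ _ = `[- r 0%N, r 0%N]%classic).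
      rewrite lebesgue_measure_itv/= lte_fin ifT; last by lra.
      by rewrite -EFinD; congr (_%:E); ring.
    by apply/seteqP; split => x; rewrite /shadow/= in_itv/= ler_norml.
  rewrite /energy big_ord1 /= expr0 !mul1r mulfK ?gt_eqF//; lra.
have [q1 q2 q3] := mean_shadow_step tpi lr.
have /andP[IH1 IH2] := IH _ (lacunaryS lr).
have q0 := mean_shadow_ge0 theta n (r \o S).
have qr := mean_shadow_le theta (lacunaryS lr).
have r1 := lacunary_gt0 (isT : (1 <= n.+1)%N) lr.
have r01 := lr.2 0%N isT.
have r0 : 0 < r 0%N by rewrite /= in r01; lra.
rewrite energyS.
move: q1 q2 q3 IH1 IH2 q0 qr.
move: (mean_shadow _ n.+1 r) (mean_shadow _ n _) (energy _ _) => q' q E.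
rewrite /= => q1 q2 q3 IH1 IH2 q0 qr.
(* In the variables u = q / r_0 and w = q E the claim is polynomial. *)
pose u := q / r 0%N.
have u0 : 0 <= u by rewrite divr_ge0// ltW.
have u2 : u <= 2 by rewrite ler_pdivrMr//; lra.
have q'1 : u <= q' / r 0%N by rewrite ler_pM2r ?invr_gt0.
have E0 : 0 <= E.
  have [//|E0] := leP 0 E; nra.
have q'2 : q' <= q * (4 - u / 16).
  apply: (le_trans q2); rewrite /u le_eqVlt; apply/orP; left; apply/eqP.
  by field; rewrite gt_eqF.
have q'3 : q * (4 - 45 * u) <= q'.
  apply: le_trans q3; rewrite /u le_eqVlt; apply/orP; left; apply/eqP.
  by field; rewrite gt_eqF.
have q'u : q' / r 0%N <= u * (4 - u / 16).
  by rewrite /u mulrAC ler_pM2r ?invr_gt0.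
have q'u3 : u * (4 - 45 * u) <= q' / r 0%N.
  by rewrite {1}/u mulrAC ler_pM2r ?invr_gt0.
have q'E2 : q' * E <= (q * E) * (4 - u / 16).
  by rewrite mulrAC ler_wpM2r.
have q'E3 : (q * E) * (4 - 45 * u) <= q' * E.
  by rewrite mulrAC ler_wpM2r.
rewrite mulrDr mulrA.
have q'E0 : 0 <= q' * E by rewrite mulr_ge0//; lra.
clear q'2 q'3.
move: IH1 IH2 q'1 q'u q'u3 q'E2 q'E3 q'E0 u0 u2.
move: (q' / r 0%N) (q * E) (q' * E) u => a w b u; clear.
move=> w1 w2 ua a1 a2 b1 b2 b0 u0 u2; apply/andP; split.
  have [u15|u15] := leP (1 / 15) u; first by lra.
  nra.
nra.
Qed.

End mean_shadow.

(** * Second moments of sums over independent branches *)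

Section second_moment.
Context {R : realType}.
Local Notation Rot := (@rotations R).
Variable m : probability Rot R.
Hypothesis m_iid : iid_uniform m.
Local Open Scope ereal_scope.

Definition branch_sum (W : Rot -> \bar R) (f : Rot) : \bar R :=
  \sum_(j < 4) W (subtree j f).

Lemma measurable_branch_sum (W : Rot -> \bar R) :
  measurable_fun setT W -> measurable_fun setT (branch_sum W).
Proof.
move=> mW; apply: emeasurable_sum => j.
exact: measurableT_comp mW (measurable_subtree j).
Qed.

Lemma branch_sum_ge0 (W : Rot -> \bar R) :
  (forall f, 0 <= W f) -> forall f, 0 <= branch_sum W f.
Proof. by move=> W0 f; apply: sume_ge0. Qed.

Lemma integral_branch_sum (W : Rot -> \bar R) (e : R) :
  measurable_fun setT W -> (forall f, 0 <= W f) ->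
  \int[m]_f W f = e%:E -> \int[m]_f branch_sum W f = (4 * e)%:E.
Proof.
move=> mW W0 We; rewrite /branch_sum ge0_integral_sum//; last first.
  by move=> j; exact: measurableT_comp mW (measurable_subtree j).
under eq_bigr do rewrite integral_subtree// We.
by rewrite sume_const -EFinM.
Qed.

(** Of the sixteen products, the twelve between distinct branches have the mean
of independent variables, so the variance is multiplied by four. *)
Lemma second_moment_branch_sum (W : Rot -> \bar R) (e v : R) :
  measurable_fun setT W -> (forall f, 0 <= W f) ->
  \int[m]_f W f = e%:E -> \int[m]_f (W f * W f) <= (e ^+ 2 + v)%:E ->
  \int[m]_f (branch_sum W f * branch_sum W f) <= ((4 * e) ^+ 2 + 4 * v)%:E.
Proof.
move=> mW W0 We Wv.
have e0 : (0 <= e)%R by rewrite -lee_fin -We integral_ge0.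
have mWj j : measurable_fun setT (fun f => W (subtree j f)).
  exact: measurableT_comp mW (measurable_subtree j).
have expand f : branch_sum W f * branch_sum W f =
    \sum_(j < 4) \sum_(l < 4) W (subtree j f) * W (subtree l f).
  rewrite {1}/branch_sum ge0_sume_distrl//; apply: eq_bigr => j _.
  by rewrite ge0_sume_distrr.
under eq_integral do rewrite expand.
rewrite ge0_integral_sum//; last 2 first.
- by move=> j; apply: emeasurable_sum => l; exact: emeasurable_funM.
- by move=> j f _; apply: sume_ge0 => l _; exact: mule_ge0.
have offdiag j l : j != l ->
    \int[m]_f (W (subtree j f) * W (subtree l f)) = (e ^+ 2)%:E.
  move=> jl.
  pose F (z : Rot * (Rot * measurableTypeR R)) := W z.1 * W z.2.1.
  have mF : measurable_fun setT F.
    apply: emeasurable_funM.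
      exact: (measurableT_comp mW measurable_fst).
    exact: (measurableT_comp mW (measurableT_comp measurable_fst measurable_snd)).
  have F0 z : 0 <= F z by exact: mule_ge0.
  have := integral_branches m_iid jl mF F0; rewrite /F/= => ->.
  transitivity (\int[m]_g (e%:E * W g)).
    apply: eq_integral => g _.
    rewrite -We -ge0_integralZr//.
    transitivity (\int[m]_h (W g * W h)).
      apply: eq_integral => h _; rewrite integral_cst// [X in _ * X](_ : _ = 1) ?mule1//.
      exact: probability_setT.
    by apply: eq_integral => h _; rewrite muleC.
  by rewrite ge0_integralZl// We -EFinM expr2.
have bound j : \int[m]_f (\sum_(l < 4) W (subtree j f) * W (subtree l f)) <=
    (4 * e ^+ 2 + v)%:E.
  rewrite ge0_integral_sum//; last 2 first.
  - by move=> l; exact: emeasurable_funM.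
  - by move=> l f _; exact: mule_ge0.
  rewrite (bigD1 j)//=.
  rewrite (eq_bigr (fun=> (e ^+ 2)%:E)); last first.
    by move=> l lj; rewrite offdiag// eq_sym.
  rewrite (@integral_subtree _ _ m_iid j (fun f => W f * W f))//; last 2 first.
  - exact: emeasurable_funM.
  - by move=> f; exact: mule_ge0.
  rewrite sumEFin sumr_const cardC1 card_ord.
  apply: (le_trans (leeD2r _ Wv)); rewrite -EFinD lee_fin.
  by rewrite -mulr_natl /=; lra.
apply: (le_trans (lee_sum _ (fun j _ => bound j))).
rewrite sume_const -EFinM lee_fin exprMn; lra.
Qed.

(** Chebyshev's inequality. *)
Lemma deviation_bound (W : Rot -> \bar R) (e v t : R) : (0 < t)%R ->
  measurable_fun setT W -> (forall f, 0 <= W f) ->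
  \int[m]_f W f = e%:E -> \int[m]_f (W f * W f) <= (e ^+ 2 + v)%:E ->
  m [set f | (e + t)%:E <= W f] <= (v / t ^+ 2)%:E.
Proof.
move=> t0 mW W0 We Wv.
have e0 : (0 <= e)%R by rewrite -lee_fin -We integral_ge0.
set A := [set f | _].
have mA : measurable A.
  rewrite -[A]setTI; have := emeasurable_fun_c_infty measurableT mW (e + t)%:E.
  by [].
have t2 : (0 < t ^+ 2)%R by rewrite exprn_gt0.
have mI : measurable_fun setT (fun f : Rot => (t ^+ 2 * \1_A f)%:E).
  by apply: measurableT_comp => //; apply: measurable_funM.
(* This is t^2 1_A <= (W - e)^2 with all terms moved to where they are positive. *)
have : \int[m]_f ((t ^+ 2 * \1_A f)%:E + (2 * e)%:E * W f) <=
    \int[m]_f (W f * W f + (e ^+ 2)%:E).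
  apply: le_ge0_integral => f _.
    apply: adde_ge0; first by rewrite lee_fin mulr_ge0 ?(ltW t2)// indicE ler0n.
    by rewrite mule_ge0// lee_fin mulr_ge0.
  have := W0 f; rewrite indicE; case: (boolP (f \in A)) => [|fA].
    rewrite inE /A /=; case: (W f) => [w| |]//= ew _; last by rewrite mulyy addye// leey.
    by move: ew; rewrite -!EFinM -!EFinD !lee_fin mulr1; nra.
  case: (W f) => [w| |]//= _; last by rewrite mulyy addye// leey.
  rewrite -!EFinM -!EFinD !lee_fin mulr0 add0r.
  by have := sqr_ge0 (w - e); rewrite sqrrB -mulr_natl; lra.
rewrite ge0_integralD//; last 3 first.
- by move=> f _; rewrite lee_fin mulr_ge0 ?(ltW t2)// indicE ler0n.
- by move=> f _; rewrite mule_ge0// lee_fin mulr_ge0.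
- exact: measurable_funeM.
rewrite ge0_integralD//; last 3 first.
- by move=> f _; exact: mule_ge0.
- exact: emeasurable_funM.
- by move=> f _; rewrite lee_fin exprn_ge0.
under [X in X + _ <= _]eq_integral do rewrite EFinM.
rewrite ge0_integralZl_EFin//; last 2 first.
- by apply: measurableT_comp => //.
- exact: ltW.
rewrite integral_indic// setIT ge0_integralZl//; last by rewrite lee_fin mulr_ge0.
rewrite We integral_cst// [X in _ <= _ + _ * X](_ : _ = 1) ?mule1; last exact: probability_setT.
move=> /le_trans/(_ (leeD2r _ Wv)) H.
have {}H : (t ^+ 2)%:E * m A + (2 * e)%:E * e%:E <=
    (e ^+ 2 + v)%:E + (e ^+ 2)%:E by exact: H.
have mAE : m A = (fine (m A))%:E by rewrite fineK//; exact: fin_num_measure.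
move: H; rewrite mAE -!EFinM -!EFinD !lee_fin ler_pdivlMr// => H; nra.
Qed.

End second_moment.

(** * Shadows averaged over all directions *)

Section piece_sums.
Context {R : realType}.
Local Notation Rot := (@rotations R).
Local Notation RR := (measurableTypeR R).
Local Notation mu := (@lebesgue_measure R).
Variable m : probability Rot R.
Hypothesis m_iid : iid_uniform m.
Implicit Types (n k : nat) (r : nat -> R) (f : Rot).

Definition shadow_integral n r f : \bar R :=
  (\int[mu]_(t in `[0%R, pi]) mu (shadow t n r f))%E.

Lemma measurable_fun_shadow_pair n r :
  measurable_fun setT (fun z : RR * Rot => mu (shadow z.1 n r z.2)).
Proof.
exact: (@measurable_fun_measure_graph _ _ _ (fun z : RR * Rot => shadow z.1 n r z.2)
  (measurable_shadow_graph n r)).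
Qed.

Lemma measurable_fun_shadow_angle n r f :
  @measurable_fun _ _ RR _ setT (fun t => mu (shadow t n r f)).
Proof.
have mp : measurable_fun setT (fun t : RR => (t, f)) by exact: measurable_fun_pair.
exact: (measurableT_comp (measurable_fun_shadow_pair n r) mp).
Qed.

Let restricted n r (z : Rot * RR) : \bar R :=
  (mu (shadow z.2 n r z.1) * (\1_(`[0%R, pi]%classic) z.2)%:E)%E.

Let shadow_integralE n r f :
  shadow_integral n r f = (\int[mu]_t restricted n r (f, t))%E.
Proof. by rewrite /shadow_integral integral_mkcond epatch_indic. Qed.

Let measurable_restricted n r : measurable_fun setT (restricted n r).
Proof.
apply: emeasurable_funM.
  have msw : measurable_fun setT (fun z : Rot * RR => (z.2, z.1)).
    by apply: measurable_fun_pair; [exact: measurable_snd|exact: measurable_fst].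
  exact: (measurableT_comp (measurable_fun_shadow_pair n r) msw).
apply: measurableT_comp => //.
have mI : measurable_fun setT (\1_(`[0%R, pi]%classic) : RR -> R).
  exact: measurable_indic.
exact: (measurableT_comp mI measurable_snd).
Qed.

Let restricted_ge0 n r z : (0 <= restricted n r z)%E.
Proof. by rewrite mule_ge0// lee_fin indicE ler0n. Qed.

Lemma measurable_shadow_integral n r : measurable_fun setT (shadow_integral n r).
Proof.
rewrite (_ : shadow_integral n r = fun f => \int[mu]_t restricted n r (f, t))%E.
  exact: (@measurable_fun_fubini_tonelli_F _ _ _ _ _ mu (restricted n r)).
by apply/funext => f; exact: shadow_integralE.
Qed.

Lemma shadow_integral_ge0 n r f : (0 <= shadow_integral n r f)%E.
Proof. exact: integral_ge0. Qed.

Lemma mean_shadow_integral n r :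
  (\int[m]_f shadow_integral n r f =
   \int[mu]_(t in `[0%R, pi]) \int[m]_f mu (shadow t n r f))%E.
Proof.
transitivity (\int[m]_f \int[mu]_t restricted n r (f, t))%E.
  by apply: eq_integral => f _; exact: shadow_integralE.
have := @fubini_tonelli _ _ _ _ _ m mu (restricted n r)
  (@measurable_restricted n r) (@restricted_ge0 n r).
rewrite /fubini_F /fubini_G => ->.
rewrite [RHS]integral_mkcond epatch_indic; apply: eq_integral => t _.
by rewrite /restricted/= ge0_integralZr//; exact: measurable_fun_shadow.
Qed.

Lemma mean_shadow_integral_bounds n r : lacunary n r ->
  exists2 e, (\int[m]_f shadow_integral n r f = e%:E)%E &
    2 / 15 <= e * energy n r <= 1024.
Proof.
move=> lr.
have S0 : 0 < energy n r.
  rewrite /energy big_ord_recl ltr_pwDl//.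
    by rewrite invr_gt0 expr0 mul1r (lacunary_gt0 (leq0n n)).
  apply: sumr_ge0 => k _; rewrite invr_ge0 mulr_ge0// ltW//.
  by rewrite (@lacunary_gt0 _ n)//; exact: ltn_ord.
have p0 := pi_gt0 R; have p2 := pi_ge2 R; have p4 := @pi_lt4 R.
have mupi : mu `[0%R, (pi : R)]%classic = pi%:E.
  by rewrite lebesgue_measure_itv/= lte_fin p0 -EFinD subr0.
have itvpi c : (\int[mu]_(t in `[0%R, (pi : R)]) (cst c%:E t) = (c * pi)%:E)%E.
  by rewrite integral_cst// [X in (_ * X)%E](_ : _ = pi%:E).
have up : (\int[m]_f shadow_integral n r f <= (256 / energy n r * pi)%:E)%E.
  rewrite mean_shadow_integral -itvpi; apply: le_ge0_integral => t /=.
    by move=> _; exact: integral_ge0.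
  rewrite in_itv/= => tpi; rewrite mean_shadowE// lee_fin ler_pdivlMr//.
  by have /andP[] := mean_shadow_energy m_iid tpi lr.
have lo : ((1 / 15 / energy n r * pi)%:E <= \int[m]_f shadow_integral n r f)%E.
  rewrite mean_shadow_integral -itvpi; apply: le_ge0_integral => t /=.
    by move=> _; rewrite lee_fin divr_ge0// ltW.
  rewrite in_itv/= => tpi; rewrite mean_shadowE// lee_fin ler_pdivrMr//.
  by have /andP[] := mean_shadow_energy m_iid tpi lr.
move: up lo; case: (\int[m]_f _)%E => [e| |]// up lo; exists e => //.
move: up lo; rewrite !lee_fin mulrAC ler_pdivlMr// => up.
rewrite mulrAC ler_pdivrMr// => lo; apply/andP; split; lra.
Qed.

Lemma shadow_integral_le n r f : lacunary n r ->
  (shadow_integral n r f <= (8 * r 0%N)%:E)%E.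
Proof.
move=> lr; have p0 := pi_gt0 R; have p4 := @pi_lt4 R.
have r0 : 0 < r 0%N by exact: lacunary_gt0 lr.
apply: (@le_trans _ _ (\int[mu]_(t in `[0%R, pi]) cst (2 * r 0%N)%:E t)%E).
  by apply: le_ge0_integral => // t _; exact: shadow_measure_le.
have mupi : mu `[0%R, (pi : R)]%classic = pi%:E.
  by rewrite lebesgue_measure_itv/= lte_fin p0 -EFinD subr0.
rewrite integral_cst// [X in (_ * X)%E](_ : _ = pi%:E)//.
by rewrite -EFinM lee_fin; nra.
Qed.

(** Subadditivity of length over the four children. *)
Lemma shadow_integralS n r f :
  (shadow_integral n.+1 r f <= branch_sum (shadow_integral n (r \o S)) f)%E.
Proof.
rewrite /branch_sum /shadow_integral -ge0_integral_sum//; last first.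
  move=> j; apply: measurable_funTS; exact: measurable_fun_shadow_angle.
apply: le_ge0_integral => // t _; rewrite shadowS.
apply: (le_trans (Boole_inequality mu (A := branch_shadow t n r f) _)).
  by move=> i _; exact: measurable_branch_shadow.
apply: lee_sum => j _; rewrite le_eqVlt; apply/orP; left; apply/eqP.
rewrite -[in RHS](inord_val j).
exact: (lebesgue_measure_translate _
  (measurable_shadow t n (r \o S) (subtree (inord j) f))).
Qed.

(** The sum of the contributions of the 4^k pieces of generation k, each taken
with its own n further generations. *)
Fixpoint piece_sum k n r : Rot -> \bar R :=
  if k is k'.+1 then branch_sum (piece_sum k' n (r \o S))
  else shadow_integral n r.

Lemma measurable_piece_sum k n r : measurable_fun setT (piece_sum k n r).
Proof.
elim: k r => [|k IH] r /=; first exact: measurable_shadow_integral.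
exact: measurable_branch_sum.
Qed.

Lemma piece_sum_ge0 k n r f : (0 <= piece_sum k n r f)%E.
Proof.
elim: k r f => [|k IH] r f /=; first exact: shadow_integral_ge0.
by apply: branch_sum_ge0 => g; exact: IH.
Qed.

Lemma shadow_integral_le_piece_sum k n r f :
  (shadow_integral (k + n) r f <= piece_sum k n r f)%E.
Proof.
elim: k r f => [|k IH] r f //=.
rewrite addSn (le_trans (shadow_integralS _ _ _))//.
by apply: lee_sum => j _; exact: IH.
Qed.

(** The variance is the number of pieces times the second moment of one piece,
which is at most (8 r_k)^2 by [shadow_integral_le]. *)
Lemma piece_sum_moments k n r : lacunary (k + n) r ->
  exists e, [/\ (\int[m]_f piece_sum k n r f = (4 ^+ k * e)%:E)%E,
    (\int[m]_f (piece_sum k n r f * piece_sum k n r f) <=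
      ((4 ^+ k * e) ^+ 2 + 4 ^+ k * (8 * r k) ^+ 2)%:E)%E &
    e * energy n (r \o addn k) <= 1024].
Proof.
elim: k r => [|k IH] r.
  rewrite add0n => lr; have [e eE /andP[_ e2]] := mean_shadow_integral_bounds lr.
  exists e; rewrite !expr0 !mul1r; split => //=.
  have r0 : 0 < r 0%N by exact: lacunary_gt0 lr.
  apply: (@le_trans _ _ (\int[m]_f cst ((8 * r 0%N) ^+ 2)%:E f)%E).
    apply: le_ge0_integral => f _; first by rewrite mule_ge0// shadow_integral_ge0.
    rewrite expr2 EFinM; apply: lee_pmul; rewrite ?shadow_integral_ge0//;
    exact: shadow_integral_le.
  rewrite integral_cst// [X in (_ * X)%E](_ : _ = 1%E) ?mule1; last exact: probability_setT.
  by rewrite lee_fin lerDr sqr_ge0.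
rewrite addSn => lr; have [e [e1 e2 e3]] := IH _ (lacunaryS lr).
exists e; split => //.
- rewrite exprS -mulrA; apply: integral_branch_sum => //.
  + exact: measurable_piece_sum.
  + by move=> f; exact: piece_sum_ge0.
- rewrite [4 ^+ k.+1]exprS -!mulrA; apply: second_moment_branch_sum => //.
  + exact: measurable_piece_sum.
  + by move=> f; exact: piece_sum_ge0.
Qed.

End piece_sums.

(** * Plane geometry *)

Section plane_geometry.
Context {R : realType}.
Implicit Types (x y z c : R * R) (theta t : R).

Lemma eucl_dist_ge0 x y : 0 <= eucl_dist x y.
Proof. exact: sqrtr_ge0. Qed.

Lemma eucl_distC x y : eucl_dist x y = eucl_dist y x.
Proof. by rewrite /eucl_dist -sqrrN opprB -[in X in _ + X]sqrrN opprB. Qed.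

Lemma eucl_dist_sqr x y :
  eucl_dist x y ^+ 2 = (x.1 - y.1) ^+ 2 + (x.2 - y.2) ^+ 2.
Proof. by rewrite sqr_sqrtr// addr_ge0 ?sqr_ge0. Qed.

Lemma eucl_dist_le x y (d : R) : 0 <= d ->
  (eucl_dist x y <= d) = ((x.1 - y.1) ^+ 2 + (x.2 - y.2) ^+ 2 <= d ^+ 2).
Proof. by move=> d0; rewrite -eucl_dist_sqr ler_sqr// nnegrE eucl_dist_ge0. Qed.

Lemma eucl_dist_triangle y x z : eucl_dist x z <= eucl_dist x y + eucl_dist y z.
Proof.
have := eucl_dist_ge0 x y; have := eucl_dist_ge0 y z => u0 v0.
rewrite eucl_dist_le ?addr_ge0//.
have := eucl_dist_sqr x y; have := eucl_dist_sqr y z; move: u0 v0.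
move: (eucl_dist x y) (eucl_dist y z) => u v v0 u0.
set a := x.1 - y.1; set b := x.2 - y.2; set a' := y.1 - z.1; set b' := y.2 - z.2.
have -> : x.1 - z.1 = a + a' by rewrite /a /a'; ring.
have -> : x.2 - z.2 = b + b' by rewrite /b /b'; ring.
move: a b a' b' => a b a' b' v2 u2.
have : a * a' + b * b' <= u * v; last by move=> ?; nra.
have [h|h] := leP (a * a' + b * b') 0; first by rewrite (le_trans h)// mulr_ge0.
rewrite -ler_sqr ?nnegrE ?mulr_ge0 ?(ltW h)// [leRHS]exprMn u2 v2.
have := sqr_ge0 (a * b' - a' * b); nra.
Qed.

Lemma proj_angle_lipschitz theta x y :
  `|proj_angle theta x - proj_angle theta y| <= eucl_dist x y.
Proof.
rewrite -ler_sqr ?nnegrE ?eucl_dist_ge0// real_normK ?num_real// eucl_dist_sqr.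
rewrite /proj_angle.
have -> : x.1 * cos theta + x.2 * sin theta - (y.1 * cos theta + y.2 * sin theta) =
  (x.1 - y.1) * cos theta + (x.2 - y.2) * sin theta by ring.
have := cos2Dsin2 theta; move: (cos _) (sin _) (x.1 - y.1) (x.2 - y.2) => c s a b cs.
have := sqr_ge0 (a * s - b * c).
have -> : a ^+ 2 + b ^+ 2 = (a ^+ 2 + b ^+ 2) * (c ^+ 2 + s ^+ 2) by rewrite cs mulr1.
by move=> ?; nra.
Qed.

Lemma proj_angle_shift theta c t :
  let x := (c.1 + t * cos theta, c.2 + t * sin theta) in
  proj_angle theta x = proj_angle theta c + t /\ eucl_dist x c = `|t|.
Proof.
split; rewrite /proj_angle/=.
  have := cos2Dsin2 theta; move: (cos _) (sin _) => a b ab.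
  transitivity (c.1 * a + c.2 * b + t * (a ^+ 2 + b ^+ 2)); first by ring.
  by rewrite ab mulr1.
rewrite /eucl_dist/= -sqrtr_sqr; congr Num.sqrt.
transitivity (t ^+ 2 * (cos theta ^+ 2 + sin theta ^+ 2)); first by ring.
by rewrite cos2Dsin2 mulr1.
Qed.

End plane_geometry.

(** * Projections of neighbourhoods of the Cantor set *)

Section cantor_geometry.
Context {R : realType}.
Local Notation Rot := (@rotations R).
Local Notation mu := (@lebesgue_measure R).
Local Notation center := (@Pilot.Defs.center R).
Implicit Types (r : nat -> R) (f : Rot) (i : word) (theta : R).

Lemma proj_center_cons theta r f (j : 'I_4) i :
  proj_angle theta (center r f (j :: i)) = proj_angle theta (center r f i) +
    (r (size i) - r (size i).+1) * cos (f i + 2 * pi * j%:R / 4 - theta).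
Proof.
rewrite /proj_angle /unitv /= cosB.
by move: (cos _) (sin _) (cos theta) (sin theta) => a b c d; ring.
Qed.

Lemma proj_center_rcons theta r f (j : 'I_4) i :
  proj_angle theta (center r f (rcons i j)) =
    (r 0%N - r 1%N) * cos (f [::] + 2 * pi * j%:R / 4 - theta) +
    proj_angle theta (center (r \o S) (subtree j f) i).
Proof.
elim: i => [|k i IH].
  by rewrite proj_center_cons /proj_angle/= !mul0r !addr0 add0r.
by rewrite rcons_cons proj_center_cons IH size_rcons -addrA proj_center_cons.
Qed.

(** Links the recursion from the root with the definition of the centers, which
appends letters at the leaves. *)
Lemma shadowP theta n r f x : shadow theta n r f x <->
  exists2 i : word, size i = n & `|x - proj_angle theta (center r f i)| <= r n.
Proof.
elim: n r f x => [|n IH] r f x.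
  rewrite /shadow; split => [xr|[i /size0nil ->]].
    by exists [::]; rewrite // /proj_angle/= !mul0r addr0 subr0.
  by rewrite /proj_angle/= !mul0r addr0 subr0.
split.
  move=> [j /IH[i ni xi]]; exists (rcons i j); first by rewrite size_rcons ni.
  by rewrite proj_center_rcons opprD addrA.
move=> [i]; case/lastP: i => [//|i j]; rewrite size_rcons => -[ni].
rewrite proj_center_rcons opprD addrA => xi.
by exists j; apply/IH; exists i.
Qed.

Lemma center_step r f (j : 'I_4) i : (forall n, r n.+1 <= r n) ->
  eucl_dist (center r f (j :: i)) (center r f i) =
  r (size i) - r (size i).+1.
Proof.
move=> rdec.
have := (proj_angle_shift (f i + 2 * pi * j%:R / 4) (center r f i)
  (r (size i) - r (size i).+1)).2.
by rewrite ger0_norm// subr_ge0.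
Qed.

(** The centers along the branch that continues i with the letter 0 form a
Cauchy sequence; its limit lies in every disc of that branch and of its
ancestors. *)
Lemma cantor_set_meets_disc r f i : (forall n, 0 <= r n) ->
  (forall n, r n.+1 <= r n) ->
  exists2 z, cantor_set r f z & eucl_dist z (center r f i) <= r (size i).
Proof.
move=> r0 rdec.
pose d k : word := nseq k ord0 ++ i.
have sd k : size (d k) = (k + size i)%N by rewrite size_cat size_nseq.
pose c k := center r f (d k).
have cS k : eucl_dist (c k.+1) (c k) = r (k + size i)%N - r (k.+1 + size i)%N.
  by rewrite /c (_ : d k.+1 = ord0 :: d k)// center_step// sd addSn.
have rle k l : r (k + l)%N <= r l.
  by elim: k => [|k IH]; [rewrite add0n|rewrite addSn (le_trans (rdec _))].
have cD k l : eucl_dist (c (k + l)%N) (c l) <= r (l + size i)%N - r (k + l + size i)%N.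
  elim: k => [|k IH].
    by rewrite add0n subrr /eucl_dist !subrr expr0n/= addr0 sqrtr0.
  rewrite addSn (le_trans (eucl_dist_triangle (c (k + l)%N) _ _))//.
  by rewrite cS; lra.
have coord (g : R * R -> R) :
    (forall x y, `|g x - g y| <= eucl_dist x y) -> cvgn (g \o c).
  move=> glip.
  have cr : cvgn (fun k => r (k + size i)%N).
    apply: nonincreasing_is_cvgn.
      by apply/nonincreasing_seqP => k; rewrite addSn.
    by exists 0 => _ [k _ <-].
  (* The step from c k to c k.+1 is at most the decrease of the radius, so adding
     the radius makes the coordinate monotone. *)
  have cs : cvgn (fun k => g (c k) + r (k + size i)%N).
    apply: nonincreasing_is_cvgn.
      apply/nonincreasing_seqP => k; have := glip (c k.+1) (c k).
      by rewrite cS ler_norml; lra.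
    exists (g (c 0%N) - r (size i)) => _ [k _ <-].
    have := glip (c (k + 0)%N) (c 0%N); have := cD k 0%N; have := r0 (k + size i)%N.
    rewrite !addn0 add0n ler_norml; lra.
  have -> : g \o c = (fun k => g (c k) + r (k + size i)%N) \-
      (fun k => r (k + size i)%N).
    by apply/funext => k /=; rewrite addrK.
  exact: is_cvgB.
have c1 : cvgn (fst \o c).
  apply: coord => x y; rewrite -ler_sqr ?nnegrE ?eucl_dist_ge0//.
  by rewrite real_normK ?num_real// eucl_dist_sqr lerDl sqr_ge0.
have c2 : cvgn (snd \o c).
  apply: coord => x y; rewrite -ler_sqr ?nnegrE ?eucl_dist_ge0//.
  by rewrite real_normK ?num_real// eucl_dist_sqr lerDr sqr_ge0.
pose z := (limn (fst \o c), limn (snd \o c)).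
have zD l : eucl_dist z (c l) <= r (l + size i)%N.
  rewrite eucl_dist_le//.
  have cv : (((c k).1 - (c l).1) ^+ 2 + ((c k).2 - (c l).2) ^+ 2) @[k --> \oo] -->
      ((z.1 - (c l).1) ^+ 2 + (z.2 - (c l).2) ^+ 2).
    by apply: cvgD; rewrite expr2; under eq_fun do rewrite expr2;
      apply: cvgM; apply: cvgB => //; apply: cvg_cst.
  rewrite -(cvg_lim _ cv)//; apply: limr_le; first by apply/cvg_ex; eexists; exact: cv.
  exists l => // k /= lk.
  rewrite -eucl_dist_le// -(subnK lk) (le_trans (cD _ _))//.
  by have := r0 (k - l + l + size i)%N; lra.
exists z; last by have := zD 0%N.
move=> n _ /=; have [ni|ni] := leqP (size i) n.
  exists (d (n - size i)%N) => /=; first by rewrite sd subnK.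
  by rewrite /word_disc /disc /= sd; exact: zD.
have anc k : exists2 i' : word, size i' = (size i - k)%N &
    eucl_dist (center r f i) (center r f i') <= r (size i - k)%N - r (size i).
  elim: k => [|k [i' si' ii']].
    exists i; rewrite ?subn0//.
    by rewrite /eucl_dist !subrr expr0n/= addr0 sqrtr0.
  case: i' si' ii' => [|j i'] si' ii'.
    exists [::]; first by rewrite subnS -si'.
    by move: ii'; rewrite subnS -si'.
  exists i'; first by rewrite subnS -si'.
  rewrite subnS -si' /= (le_trans (eucl_dist_triangle (center r f (j :: i')) _ _))//.
  by rewrite center_step//; move: ii'; rewrite -si' /=; lra.
(* For n < size i the disc of generation n around z is that of an ancestor of i. *)
have [i' si' ii'] := anc (size i - n)%N.
move: si' ii'; rewrite subKn ?(ltnW ni)// => si' ii'.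
exists i' => //=; rewrite /word_disc /disc /= si'.
rewrite (le_trans (eucl_dist_triangle (center r f i) _ _))//.
have := zD 0%N; rewrite /c /d /= add0n; lra.
Qed.

(** When r n <= rho <= r k / 3 for all k < n, this changes the radii of
generations 0 to n only at generation n, where it puts rho. *)
Definition truncate_radii r (rho : R) (k : nat) : R := Num.max (r k) rho.

Section scale.
Variables (r : nat -> R) (n : nat) (rho : R).
Hypotheses (r_ge0 : forall k, 0 <= r k) (r_dec : forall k, r k.+1 <= r k).
Hypotheses (rho_gt0 : 0 < rho) (rn_rho : r n <= rho)
  (rho_r : forall k, (k < n)%N -> 3 * rho <= r k).
Local Notation r' := (truncate_radii r rho).

Lemma truncated_radius k : (k < n)%N -> r' k = r k.
Proof. by move=> kn; rewrite /truncate_radii max_l//; have := rho_r kn; move: rho_gt0; lra. Qed.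

Lemma truncated_radius_last : r' n = rho.
Proof. by rewrite /truncate_radii max_r. Qed.

(** Only the last step of the path to the center changes, and its length changes
by rho - r n. *)
Lemma proj_truncated_center theta f i : size i = n ->
  `|proj_angle theta (center r f i) - proj_angle theta (center r' f i)| <= rho - r n.
Proof.
have eqc (i' : word) : (size i' < n)%N -> center r' f i' = center r f i'.
  elim: i' => [//|j i' IH] ji' /=.
  by rewrite IH 1?ltnW// !truncated_radius// ltnW.
case: i => [|j i] si.
  by rewrite /proj_angle/= subrr normr0 subr_ge0.
have si' : (size i).+1 = n by [].
have lti : (size i < n)%N by rewrite -si'.
have e1 : r' (size i).+1 = rho by rewrite si' truncated_radius_last.
rewrite !proj_center_cons eqc// truncated_radius// e1 si'.
move: (proj_angle _ _) (cos_max (f i + 2 * pi * j%:R / 4 - theta)) => p.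
move: (cos _) => c c1.
rewrite (_ : _ - _ = (rho - r n) * c); last by ring.
by rewrite normrM ger0_norm ?subr_ge0// ler_piMr ?subr_ge0.
Qed.

(** Every disc of generation n contains a point of the Cantor set, within r n of
its center; the center moves by at most rho - r n when the radii are truncated,
and the shadow adds rho. *)
Lemma shadow_sub_proj_nbhd theta f (s : R) : 2 * rho <= s ->
  shadow theta n r' f `<=` proj_angle theta @` nbhd (cantor_set r f) s.
Proof.
move=> rs x /shadowP[i si]; rewrite truncated_radius_last => xi.
have [z Kz zi] := cantor_set_meets_disc f i r_ge0 r_dec.
pose t := x - proj_angle theta (center r f i).
have [pX dX] := proj_angle_shift theta (center r f i) t.
exists ((center r f i).1 + t * cos theta, (center r f i).2 + t * sin theta).
  apply: le_trans (ereal_inf_lbound _) _; first by exists z.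
  rewrite lee_fin (le_trans (eucl_dist_triangle (center r f i) _ _))// dX.
  rewrite eucl_distC si in zi.
  have h1 := proj_truncated_center theta f si.
  have h2 := ler_distD (proj_angle theta (center r' f i)) x
    (proj_angle theta (center r f i)).
  rewrite distrC in h1; rewrite /t; lra.
by rewrite pX addrC subrK.
Qed.

(** An interval of radius 15 rho is tiled by fifteen translates, by multiples of
2 rho, of the concentric interval of radius rho. *)
Definition shadow_translate theta f (l : nat) : set R :=
  [set x | shadow theta n r' f (x - 2 * rho * (l%:R - 7))].

Lemma proj_nbhd_sub_shadow theta f (s : R) : s <= 12 * rho ->
  proj_angle theta @` nbhd (cantor_set r f) s `<=`
  \bigcup_(l in `I_15) shadow_translate theta f l.
Proof.
move=> s12 _ [X Xs <-].
have [y Ky yX] : exists2 y, cantor_set r f y & eucl_dist X y <= 13 * rho.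
  have : (dist_to (cantor_set r f) X < (13 * rho)%:E)%E.
    by rewrite (le_lt_trans Xs)// lte_fin; move: rho_gt0; lra.
  move=> /ereal_inf_lt[_ [y Ky <-]]; rewrite lte_fin => /ltW yX.
  by exists y.
have [i si yi] := Ky n I.
have Xi : `|proj_angle theta X - proj_angle theta (center r' f i)| <= 15 * rho.
  have h1 := proj_truncated_center theta f si.
  have h2 := proj_angle_lipschitz theta X (center r f i).
  have h3 := eucl_dist_triangle y X (center r f i).
  move: yi; rewrite /word_disc /disc/= si => yi.
  have := ler_distD (proj_angle theta (center r f i)) (proj_angle theta X)
    (proj_angle theta (center r' f i)).
  move: rho_gt0; lra.
set D := proj_angle theta X - _ in Xi.
(* The number of the interval that contains D; the minimum treats the right
   endpoint D = 15 rho. *)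
pose l := minn 14 (Num.truncn ((D + 15 * rho) / (2 * rho))).
have : 0 <= (D + 15 * rho) / (2 * rho).
  by rewrite divr_ge0// ?mulr_ge0 ?(ltW rho_gt0)//; move: Xi; rewrite ler_norml; lra.
move=> /truncn_itv/andP[]; rewrite ler_pdivlMr ?mulr_gt0// ltr_pdivrMr ?mulr_gt0//.
move: @l; move: (Num.truncn _) => p l p1 p2.
exists l; first by rewrite /= /l ltnS geq_minl.
apply/shadowP; exists i => //; rewrite truncated_radius_last.
rewrite addrAC -/D; move: Xi; rewrite !ler_norml => Xi.
rewrite /l; have [p14|p14] := leqP 14 p; last first.
  by move: p1 p2; rewrite -natr1; lra.
have : 14 * (2 * rho) <= p%:R * (2 * rho).
  by rewrite ler_wpM2r ?mulr_ge0 ?(ltW rho_gt0)// ler_nat.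
lra.
Qed.

Lemma truncated_lacunary : (forall k, r k.+1 <= r k / 3) -> lacunary n r'.
Proof.
move=> r3; split; first by rewrite truncated_radius_last.
move=> k kn; rewrite (truncated_radius kn).
have [kn'|] := ltnP k.+1 n; first by rewrite truncated_radius//; have := r3 k; lra.
move=> nk; have -> : k.+1 = n by lia.
by rewrite truncated_radius_last; exact: rho_r.
Qed.

Lemma shadow_integral_le_Fav f (s : R) : 2 * rho <= s ->
  (shadow_integral n r' f <= Fav (nbhd (cantor_set r f) s))%E.
Proof.
move=> rs; apply: le_ge0_integral => // t _.
exact/le_lebesgue_measure/shadow_sub_proj_nbhd.
Qed.

Lemma Fav_le_shadow_integral f (s : R) : s <= 12 * rho ->
  (Fav (nbhd (cantor_set r f) s) <= 15%:E * shadow_integral n r' f)%E.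
Proof.
move=> rs; rewrite /shadow_integral -ge0_integralZl//; last first.
  by apply: measurable_funTS; exact: measurable_fun_shadow_angle.
apply: le_ge0_integral => // t _.
have mS l : measurable (shadow_translate t f l).
  have mf : measurable_fun setT (fun x : R => x - 2 * rho * (l%:R - 7)).
    exact: measurable_funB.
  by rewrite -[X in measurable X]setTI; apply: mf => //; exact: measurable_shadow.
have H := @proj_nbhd_sub_shadow t f s rs.
apply: (le_trans (le_lebesgue_measure H)); rewrite bigcup_mkord.
have B := Boole_inequality mu (A := shadow_translate t f) (n := 15) (fun l _ => mS l).
apply: (le_trans B).
apply: (@le_trans _ _ (\sum_(l < 15) mu (shadow t n r' f))%E).
  apply: lee_sum => l _; rewrite le_eqVlt; apply/orP; left; apply/eqP.
  exact: (lebesgue_measure_translate _ (measurable_shadow t n r' f)).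
by rewrite sume_const.
Qed.

End scale.
End cantor_geometry.

(** * Energy of a sequence of radii *)

Section energy_theory.
Context {R : realType}.
Implicit Types (r : nat -> R) (n k m : nat) (rho s : R).

Lemma energy_recr n r : energy n.+1 r = energy n r + (4 ^+ n.+1 * r n.+1)^-1.
Proof. by rewrite /energy big_ord_recr. Qed.

Lemma energy_drop m q r : energy (m.+1 + q) r =
  energy m r + energy q (r \o addn m.+1) / 4 ^+ m.+1.
Proof.
elim: m r => [|m IH] r.
  by rewrite add1n energyS [energy 0 r]/energy big_ord1 expr0 mul1r expr1.
rewrite addSn energyS IH [energy m.+1 r]energyS mulrDl -addrA.
congr (_ + (_ + _)); rewrite -mulrA; congr (_ * _).
by rewrite [4 ^+ m.+2]exprSr invfM mulrC.
Qed.

Lemma energy_ge0 n r : (forall k, 0 <= r k) -> 0 <= energy n r.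
Proof. by move=> r0; apply: sumr_ge0 => k _; rewrite invr_ge0 mulr_ge0. Qed.

Lemma energy_gt0 n r : (forall k, 0 <= r k) -> 0 < r 0%N -> 0 < energy n r.
Proof.
move=> r0 r00; rewrite /energy big_ord_recl ltr_pwDl//.
  by rewrite invr_gt0 expr0 mul1r.
by apply: sumr_ge0 => k _; rewrite invr_ge0 mulr_ge0.
Qed.

Lemma le_energy m n r : (forall k, 0 <= r k) -> (m <= n)%N ->
  energy m r <= energy n r.
Proof.
move=> r0 /subnK <-; elim: (n - m)%N => [|k IH]; first by rewrite add0n.
by rewrite addSn energy_recr (le_trans IH)// lerDl invr_ge0 mulr_ge0.
Qed.

Lemma eq_energy n r r' : (forall k, (k <= n)%N -> r k = r' k) ->
  energy n r = energy n r'.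
Proof. by move=> rr'; apply: eq_bigr => k _; rewrite rr'// -ltnS. Qed.

(** Consecutive values x, y of the left side satisfy y <= 1 + (4/3) x, since the
ratio of consecutive terms 4^k r_k is at most 4/3. *)
Lemma radius_energy_le k r : (forall k, 0 <= r k) ->
  (forall k, r k.+1 <= r k / 3) ->
  4 ^+ k * r k * energy k r <= 4 * (4 / 3) ^+ k - 3.
Proof.
move=> r0 r3; elim: k => [|k IH].
  rewrite /energy big_ord1/= !expr0 !mul1r.
  by have [->|rn0] := eqVneq (r 0%N) 0; rewrite ?mul0r ?mulfV//; lra.
rewrite energy_recr mulrDr.
have h1 : 4 ^+ k.+1 * r k.+1 * (4 ^+ k.+1 * r k.+1)^-1 <= 1.
  have [->|rn0] := eqVneq (r k.+1) 0; first by rewrite mulr0 mul0r.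
  by rewrite mulfV// mulf_neq0// expf_neq0.
have h2 : 4 ^+ k.+1 * r k.+1 * energy k r <= 4 / 3 * (4 ^+ k * r k * energy k r).
  rewrite exprS [leRHS]mulrA; apply: ler_wpM2r; first exact: energy_ge0.
  have -> : 4 / 3 * (4 ^+ k * r k) = 4 * 4 ^+ k * (r k / 3) by field.
  by rewrite ler_wpM2l// mulr_ge0// exprn_ge0.
rewrite [(4 / 3) ^+ k.+1]exprS; lra.
Qed.

(** Here a = 4^m, e is the mean of one piece, Q the energy of its radii, E the
full energy and eps the energy up to generation m. *)
Lemma threshold_arith (a e E Q eps : R) : 0 < a -> 0 <= e -> 0 < eps ->
  eps <= E -> E / 2 * a <= Q -> e * Q <= 1024 ->
  15 * (a * e + eps^-1) <= 15 * 2049 / eps.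
Proof.
move=> a0 e0 eps0 epsE EQ eQ.
have ae : a * e <= 2048 / eps.
  rewrite ler_pdivlMr//.
  have h1 : e * (E / 2 * a) <= e * Q by rewrite ler_wpM2l.
  have h2 : e * a * eps <= e * a * E by rewrite ler_wpM2l// mulr_ge0// ltW.
  lra.
lra.
Qed.

End energy_theory.

(** * Comparison at one radius *)

Section scales.
Context {R : realType}.
Local Notation Rot := (@rotations R).
Variable r : nat -> R.
Hypothesis r_adm : admissible r.
Implicit Types (n k m : nat) (rho s : R) (f : Rot).

Let r_ge0 k : 0 <= r k. Proof. by case: r_adm. Qed.
Let r_dec k : r k.+1 <= r k. Proof. by case: r_adm. Qed.
Let r_third k : r k.+1 <= r k / 3. Proof. by case: r_adm. Qed.

(** The generation n and the radius rho at which the s-neighbourhood of the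
Cantor set is compared with a union of 4^n discs of radius rho. *)
Definition scale_at s n rho := [/\ 0 < rho, r n <= rho,
  forall k, (k < n)%N -> 3 * rho <= r k & 2 * rho <= s <= 6 * rho].

(** Take the first n with r n <= s / 2, and for rho the smaller of s / 2 and r
(n - 1) / 3; the latter exceeds s / 6 since r (n - 1) > s / 2. *)
Lemma exists_scale s : 0 < s -> exists n rho, scale_at s n rho.
Proof.
move=> s0.
have small n : r n * n.+1%:R <= r 0%N.
  elim: n => [|n IH]; first by rewrite mulr1.
  have := r_third n; have := r_ge0 n; rewrite -[n.+2%:R]natr1.
  have n1 : 1 <= n.+1%:R :> R by rewrite ler1n.
  by move: IH n1; move: (n.+1%:R : R) => x; nra.
have ex : exists n, r n <= s / 2.
  pose n := Num.truncn (2 * r 0%N / s).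
  exists n; have := truncnS_gt (2 * r 0%N / s); rewrite -/n ltr_pdivrMr// => h.
  have := small n; have : 0 < n.+1%:R :> R by rewrite ltr0n.
  by move: h; move: (n.+1%:R : R) => x h x0 rx; nra.
case: (ex_minnP ex) => n rn nmin.
have low k : (k < n)%N -> s / 2 < r k.
  by move=> kn; rewrite ltNge; apply/negP => /nmin; rewrite leqNgt kn.
case: n rn nmin low => [|n] rn nmin low.
  by exists 0%N, (s / 2); split => //; lra.
have rdec k l : (k <= l)%N -> r l <= r k.
  move=> /subnK <-; elim: (l - k)%N => [|j IH]; first by rewrite add0n.
  by rewrite addSn (le_trans (r_dec _)).
exists n.+1, (Num.min (s / 2) (r n / 3)).
have hn := low n (leqnn _).
have h3 := r_third n.
split.
- by rewrite lt_min; apply/andP; split; lra.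
- by rewrite le_min rn.
- move=> k kn; have := rdec k n kn; have : Num.min (s / 2) (r n / 3) <= r n / 3.
    by rewrite ge_min lexx orbT.
  lra.
- have : Num.min (s / 2) (r n / 3) <= s / 2 by rewrite ge_min lexx.
  have : s / 6 <= Num.min (s / 2) (r n / 3) by rewrite le_min; apply/andP; split; lra.
  lra.
Qed.

Section fixed_scale.
Variables (s : R) (n : nat) (rho : R).
Hypothesis sc : scale_at s n rho.
Let r' := truncate_radii r rho.

Let rho_gt0 : 0 < rho. Proof. by case: sc. Qed.
Let rn_rho : r n <= rho. Proof. by case: sc. Qed.
Let rho_r k : (k < n)%N -> 3 * rho <= r k. Proof. by case: sc => _ _ + _; apply. Qed.
Let lac : lacunary n r'. Proof. exact: truncated_lacunary. Qed.
Let r'_ge0 k : 0 <= r' k.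
Proof. by rewrite /r' /truncate_radii le_max r_ge0. Qed.
Let r'_gt0 k : 0 < r' k.
Proof. by rewrite /r' /truncate_radii lt_max rho_gt0 orbT. Qed.

Lemma scale_energy_gt0 : 0 < energy n r'.
Proof. exact: energy_gt0. Qed.

Lemma scale_energy_eq k : (k < n)%N -> energy k r' = energy k r.
Proof.
by move=> kn; apply: eq_energy => l lk; rewrite /r' (truncated_radius _ rho_r)//;
  apply: leq_ltn_trans kn.
Qed.

Lemma piece_sum_le k q u f : lacunary (k + q) u ->
  (piece_sum k q u f <= (8 * (4 ^+ k * u k))%:E)%E.
Proof.
elim: k u f => [|k IH] u f lu /=.
  by rewrite expr0 mul1r; exact: shadow_integral_le.
apply: (le_trans (lee_sum _ (fun j _ => IH (u \o S) (subtree j f) (lacunaryS lu)))).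
by rewrite sume_const -EFinM lee_fin exprS /=; lra.
Qed.

(** The trivial bound: each of the 4^k pieces of generation k contributes at
most 8 r' k. *)
Lemma Fav_deterministic k f : (k <= n)%N -> energy n r' < 2 * energy k r' ->
  energy k r' <= 2 * (4 ^+ k * r' k)^-1 ->
  (Fav (nbhd (cantor_set r f) s) <= (480 / energy n r')%:E)%E.
Proof.
move=> kn e1 e2; have E0 := scale_energy_gt0.
have s12 : s <= 12 * rho by case: sc => _ _ _ /andP[_]; move: rho_gt0; lra.
have nE : n = (k + (n - k))%N by rewrite subnKC.
have lac' : lacunary (k + (n - k)) r' by rewrite -nE.
apply: (le_trans (Fav_le_shadow_integral rho_gt0 rn_rho rho_r f s12)).
rewrite -/r' [n in shadow_integral n]nE.
apply: (@le_trans _ _ (15%:E * piece_sum k (n - k) r' f)%E).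
  by rewrite lee_wpmul2l//; exact: shadow_integral_le_piece_sum.
apply: (@le_trans _ _ (15%:E * (8 * (4 ^+ k * r' k))%:E)%E).
  by rewrite lee_wpmul2l//; exact: piece_sum_le.
rewrite -EFinM lee_fin ler_pdivlMr//.
have a0 : 0 < 4 ^+ k * r' k by rewrite mulr_gt0// exprn_gt0.
move: e1 e2 a0 E0; move: (energy n _) (energy k _) (4 ^+ k * _) => E e a e1 e2 a0 E0.
have : a * e <= 2.
  by have := ler_wpM2l (ltW a0) e2; rewrite mulrCA mulfV ?mulr1 ?gt_eqF.
move=> ae; have : a * E <= a * (2 * e) by rewrite ler_wpM2l// ltW.
lra.
Qed.

(** Generation m + 1 is the first whose partial energy exceeds half of the full
energy, and it comes before n, so that these partial energies are those of the
original radii. *)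
Definition intermediate m :=
  [/\ (m.+1 < n)%N, energy m.+1 r <= energy n r', energy n r' < 2 * energy m.+1 r &
      2 * energy m r <= energy n r'].

(** Consider the first generation k whose partial energy exceeds half of the
full energy. If the term of index k makes up at least half of the partial
energy, the trivial bound suffices; otherwise k is neither 0 nor n. *)
Lemma scale_dichotomy :
  (forall f, (Fav (nbhd (cantor_set r f) s) <= (480 / energy n r')%:E)%E) \/
  (exists m, intermediate m).
Proof.
have E0 := scale_energy_gt0.
have ex : exists k, energy n r' < 2 * energy k r' by exists n; lra.
case: (ex_minnP ex) => k ek kmin.
have kn : (k <= n)%N by apply: kmin; lra.
case: k ek kmin kn => [|m] ek kmin kn.
  left=> f; apply: (@Fav_deterministic 0) => //.
  rewrite /energy big_ord1/= expr0 !mul1r ler_peMl//; first by rewrite invr_ge0.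
  by rewrite ler1n.
have em : 2 * energy m r' <= energy n r'.
  by rewrite leNgt; apply/negP => /kmin; rewrite ltnn.
have [h|h] := leP (2 * energy m r') (energy m.+1 r').
  left=> f; apply: (@Fav_deterministic m.+1) => //.
  by move: h; rewrite energy_recr; lra.
have mn : (m.+1 < n)%N.
  rewrite ltn_neqAle kn andbT; apply/eqP => mn.
  by move: h em; rewrite mn; lra.
right; exists m; split => //; rewrite -?scale_energy_eq//; try exact: ltnW.
by rewrite ltW// (lt_le_trans h).
Qed.

Section random.
Variable m : probability Rot R.
Hypothesis m_iid : iid_uniform m.

(** Integrate the lower bound of [mean_shadow_energy] over all directions. *)
Lemma Fav_mean_lower :
  ((2 / 15 / energy n r')%:E <= \int[m]_f shadow_integral n r' f)%E.
Proof.
have [e -> /andP[e1 _]] := mean_shadow_integral_bounds m_iid lac.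
by rewrite lee_fin ler_pdivrMr//; exact: scale_energy_gt0.
Qed.

(** Chebyshev's inequality for the sum over the pieces of generation k + 1, with
deviation 1 / energy k.+1 r. The pieces are those of the scale of s, but the
conclusion holds for every s' <= 2 s because of the slack in
[Fav_le_shadow_integral]. *)
Lemma intermediate_deviation k : intermediate k -> exists A : set Rot,
  [/\ measurable A, (m A <= (1024 * (4 / 9) ^+ k.+1)%:E)%E &
    forall f s', ~ A f -> s' <= 2 * s ->
      (Fav (nbhd (cantor_set r f) s') <= (15 * 2049 / energy k.+1 r)%:E)%E].
Proof.
move=> [kn E1 E2 E3]; have E0 := scale_energy_gt0.
set q := (n - k.+1)%N.
have nE : n = (k.+1 + q)%N by rewrite subnKC// ltnW.
have lac' : lacunary (k.+1 + q) r' by rewrite -nE.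
have [e [e1 e2 e3]] := piece_sum_moments m_iid lac'.
have eps0 : 0 < energy k.+1 r.
  by move: E2 E0; lra.
set eps := energy k.+1 r in eps0 E1 E2 *.
have t0 : 0 < eps^-1 by rewrite invr_gt0.
have mP : measurable_fun setT (piece_sum k.+1 q r') by exact: measurable_piece_sum.
have P0 f : (0 <= piece_sum k.+1 q r' f)%E by exact: piece_sum_ge0.
exists [set f | (4 ^+ k.+1 * e + eps^-1)%:E <= piece_sum k.+1 q r' f]%E; split.
- by have := emeasurable_fun_c_infty measurableT mP (4 ^+ k.+1 * e + eps^-1)%:E;
    rewrite setTI.
- apply: (le_trans (deviation_bound t0 mP P0 e1 e2)).
  rewrite lee_fin.
  have rk : r' k.+1 = r k.+1 by rewrite /r' (truncated_radius _ rho_r).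
  have h0 := @radius_energy_le R k.+1 r r_ge0 r_third.
  rewrite rk -/eps exprVn invrK.
  have -> : (4 / 9) ^+ k.+1 = ((4 / 3) ^+ k.+1) ^+ 2 / 4 ^+ k.+1 :> R.
    by rewrite exprAC -expr_div_n; congr (_ ^+ _); field.
  rewrite [leRHS]mulrA ler_pdivlMr ?exprn_gt0//.
  move: h0; rewrite -/eps; have := r_ge0 k.+1.
  have : 0 <= 4 ^+ k.+1 :> R by rewrite exprn_ge0.
  move: eps0; clear E1 E2 t0; clearbody eps.
  move: (4 ^+ k.+1) (r k.+1) ((4 / 3) ^+ k.+1) eps => a b c x x0 a0 b0 h.
  have abx0 : 0 <= a * b * x by rewrite !mulr_ge0// ltW.
  have h1 : (a * b * x) ^+ 2 <= (4 * c) ^+ 2 by nra.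
  have -> : a * (8 * b) ^+ 2 * x ^+ 2 * a = 64 * (a * b * x) ^+ 2 by ring.
  by move: h1; rewrite [(4 * c) ^+ 2]exprMn; lra.
move=> f s' /negP; rewrite -ltNge => Pf s's.
have s12 : s' <= 12 * rho by case: sc => _ _ _ /andP[_]; move: rho_gt0; lra.
apply: (le_trans (Fav_le_shadow_integral rho_gt0 rn_rho rho_r f s12)).
rewrite -/r' [n in shadow_integral n]nE.
apply: (@le_trans _ _ (15%:E * (4 ^+ k.+1 * e + eps^-1)%:E)%E).
  rewrite lee_wpmul2l//; apply: (le_trans _ (ltW Pf)).
  exact: shadow_integral_le_piece_sum.
rewrite -EFinM lee_fin.
have e0 : 0 <= e.
  have : (0 <= (4 ^+ k.+1 * e)%:E)%E by rewrite -e1; exact: integral_ge0.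
  by rewrite lee_fin pmulr_rge0// exprn_gt0.
have := energy_drop k q r'; rewrite -nE => ED.
rewrite -(scale_energy_eq (ltnW kn)) in E3.
have a0 : 0 < 4 ^+ k.+1 :> R by rewrite exprn_gt0.
move: ED E1 E3 e3 a0; move: (energy q _) (energy n r') (4 ^+ k.+1) E0 E2.
move=> Q E a E0 E2 ED E1 E3 e3 a0.
apply: (@threshold_arith _ a e E Q eps) => //.
by rewrite -ler_pdivlMr//; lra.
Qed.

End random.
End fixed_scale.

Definition intermediate_class m : set R :=
  [set s | 0 < s /\ exists n rho, scale_at s n rho /\ intermediate n rho m].

(** A point close to the supremum. *)
Lemma exists_half_supremum (S : set R) (B : R) : S !=set0 ->
  (forall s, S s -> 0 < s <= B) -> exists2 s, S s & forall s', S s' -> s' <= 2 * s.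
Proof.
move=> [s0 Ss0] SB.
have hS : has_sup S by split; [exists s0|exists B => s /SB/andP[]].
have sup0 : 0 < sup S.
  by have /andP[h _] := SB _ Ss0; rewrite (lt_le_trans h)//; apply: sup_upper_bound.
have [|s Ss sup_s] := @sup_adherent R S (sup S / 2) _ hS; first by lra.
exists s => // s' Ss'; have := sup_upper_bound hS Ss'; lra.
Qed.

(** One event serves for the whole class: apply [intermediate_deviation] at a
radius that is at least half of the supremum of the class. *)
Lemma class_deviation (m : probability Rot R) k : iid_uniform m ->
  exists A : set Rot, [/\ measurable A,
    (m A <= (1024 * (4 / 9) ^+ k.+1)%:E)%E &
    forall f s, ~ A f -> intermediate_class k s ->
      (Fav (nbhd (cantor_set r f) s) <= (15 * 2049 / energy k.+1 r)%:E)%E].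
Proof.
move=> m_iid; have [ne|empty] := pselect (intermediate_class k !=set0); last first.
  exists set0; split => //.
    rewrite measure0 lee_fin; apply: mulr_ge0; first exact: ler0n.
    by apply: exprn_ge0; rewrite divr_ge0// ler0n.
  by move=> f s _ ks; exfalso; apply: empty; exists s.
have [s' [s0 [n [rho [sc [kn _ _ _]]]]]|s [s0 [n [rho [sc int]]]] smax] :=
    exists_half_supremum (B := 2 * r 0%N) ne.
  rewrite s0/=; case: sc => rho0 _ /(_ 0%N (leq_ltn_trans (leq0n _) kn)) h /andP[_]; lra.
have [A [mA A1 A2]] := intermediate_deviation sc m_iid int.
by exists A; split => // f u fA ku; apply: A2 => //; exact: smax.
Qed.

End scales.

(** * Almost sure bounds *)

Section almost_sure_bound.
Context {R : realType}.
Local Notation Rot := (@rotations R).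

Lemma geometric_sum_bounded (u : nat -> \bar R) (c : R) : 0 <= c ->
  (forall k, 0 <= u k)%E -> (forall k, u k <= (c * (4 / 9) ^+ k.+1)%:E)%E ->
  (\sum_(k <oo) u k < +oo)%E.
Proof.
move=> c0 u0 uc.
apply: (@le_lt_trans _ _ (2 * c)%:E); last by rewrite ltry.
have p0 N : 0 <= (4 / 9 : R) ^+ N by apply: exprn_ge0; rewrite divr_ge0.
apply: lime_le; first by apply: is_cvg_nneseries.
apply: nearW => N.
apply: (@le_trans _ _ (2 * c * (1 - (4 / 9) ^+ N))%:E); last first.
  by rewrite lee_fin ler_piMr ?mulr_ge0// gerBl.
elim: N => [|N IH]; first by rewrite big_geq// expr0 subrr mulr0.
rewrite big_nat_recr//=; apply: (le_trans (leeD IH (uc N))).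
rewrite -EFinD lee_fin exprS; have := mulr_ge0 c0 (p0 N).
move: ((4 / 9) ^+ N) => p cp; lra.
Qed.

(** Borel-Cantelli, the probabilities being summable by [class_deviation]. *)
Lemma almost_sure_deviation (m : probability Rot R) (r : nat -> R) :
  iid_uniform m -> admissible r ->
  exists N : set Rot, [/\ measurable N, m N = 0%E &
    forall f, ~ N f -> exists M : nat, forall k s, (M <= k)%N ->
      intermediate_class r k s ->
      (Fav (nbhd (cantor_set r f) s) <= (15 * 2049 / energy k.+1 r)%:E)%E].
Proof.
move=> m_iid r_adm.
have [A AP] := choice (fun k => class_deviation r_adm k m_iid).
have mA k : measurable (A k) by have [] := AP k.
exists (lim_sup_set A); split.
- apply: bigcapT_measurable => k; apply: bigcup_measurable => j _; exact: mA.
- apply: lim_sup_set_cvg0 => //.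
  apply: (@geometric_sum_bounded _ 1024 (ler0n _ _)) => k.
    exact: measure_ge0.
  by have [] := AP k.
move=> f; rewrite /lim_sup_set => Nf.
have [M NM] : exists M, ~ (\bigcup_(j >= M) A j) f.
  by apply/existsNP => H; apply: Nf => k _; exact: H.
exists M => k s Mk ks; have [_ _] := AP k; apply => //.
by move=> Ak; apply: NM; exists k.
Qed.

End almost_sure_bound.

Section random_cantor_set.
Context d (T : measurableType d) (R : realType) (P : probability T R).
Variables (r : nat -> R) (omega : word -> {RV P >-> R}).
Hypotheses (r_adm : admissible r) (omega_ind : independent_rotations omega).
Local Notation Rot := (@rotations R).

Let Omega (w : T) : Rot := fun i => omega i w.

Let measurable_Omega : measurable_fun setT Omega.
Proof. by apply: measurable_rotations => i; exact: measurable_funPT. Qed.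

Let Om : {mfun T >-> Rot} := mfun_Sub (mem_set measurable_Omega).

(** The joint law of the angles, as a probability on the space of rotations. *)
Definition rotation_law : probability Rot R := distribution P Om.

Lemma rotation_law_iid : iid_uniform rotation_law.
Proof.
have [ind unif] := omega_ind => s B us mB.
have -> : rotation_law (coordinate_set s B) =
    P (\bigcap_(i in [set` s]) (omega i @^-1` B i)) by [].
rewrite ind//; apply: eq_bigr => i _; exact: (unif i (B i) (mB i)).
Qed.

Lemma integral_rotation_law (F : Rot -> \bar R) : measurable_fun setT F ->
  (forall f, 0 <= F f)%E ->
  (\int[rotation_law]_f F f = \int[P]_w F (fun i => omega i w))%E.
Proof. by move=> mF F0; rewrite ge0_integral_distribution. Qed.

Lemma EFav_lower s n rho : scale_at r s n rho ->
  ((2 / 15 / energy n (truncate_radii r rho))%:E <= EFav_nbhd r omega s)%E.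
Proof.
move=> sc; apply: (le_trans (Fav_mean_lower r_adm sc rotation_law_iid)).
rewrite integral_rotation_law; last 2 first.
- exact: measurable_shadow_integral.
- by move=> f; exact: shadow_integral_ge0.
apply: le_ge0_integral => w _; first exact: shadow_integral_ge0.
have [r0 rdec _] := r_adm; have [rho0 rn rk /andP[rs _]] := sc.
exact: (shadow_integral_le_Fav r0 rdec rho0 rn rk (Omega w) rs).
Qed.

End random_cantor_set.

Lemma ratio_le (R : realType) (a b c : R) (X Y : \bar R) : 0 < b -> 0 <= c ->
  a <= c * b -> (X <= a%:E)%E -> (b%:E <= Y)%E -> (X / Y <= c%:E)%E.
Proof.
move=> b0 c0 abc Xa; case: Y => [y| |]//; last by rewrite invey mule0 lee_fin.
rewrite lee_fin => yb; have y0 : 0 < y by exact: lt_le_trans yb.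
rewrite inver gt_eqF// lee_pdivrMr//; apply: (le_trans Xa).
by rewrite -EFinM lee_fin (le_trans abc)// ler_wpM2l.
Qed.

Theorem theorem1p7 (R : realType) :
  exists C : R,
    forall (d : measure_display) (T : measurableType d) (P : probability T R)
      (r : nat -> R) (omega : word -> {RV P >-> R}),
      admissible r ->
      independent_rotations omega ->
      EFav_nbhd r omega rho @[rho --> 0^'+] --> 0%E ->
      {ae P, forall w : T,
        (limf_esup (fun rho : R => Fav_nbhd r omega rho w / EFav_nbhd r omega rho)
                   0^'+ <= C%:E)%E}.
Proof.
(* The two cases of [scale_dichotomy] give ratios at most 480 * 15 / 2 and
   15 * 2049 * 2 * 15 / 2. *)
exists (1000 * 1000) => d T P r omega r_adm omega_ind EFav0.
have m_iid := rotation_law_iid omega_ind.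
have [N [mN N0 Nbad]] := almost_sure_deviation m_iid r_adm.
exists ((fun w i => omega i w) @^-1` N); split.
- have mO : measurable_fun setT ((fun w i => omega i w) : T -> @rotations R).
    by apply: measurable_rotations => i; exact: measurable_funPT.
  by rewrite -[X in measurable X]setTI; exact: mO.
- exact: N0.
move=> w /=; apply: contra_notP => /Nbad[M NM].
have [r0 rdec r3] := r_adm.
(* An expectation below c forces the energy above 2 (energy M r + 1), which leaves
   only generations k >= M. *)
pose c := (15 * (energy M r + 1))^-1.
have c0 : 0 < c.
  by rewrite invr_gt0 mulr_gt0// ltr_pwDr// energy_ge0.
have near0 : \forall s \near 0^'+, (EFav_nbhd r omega s < c%:E)%E.
  apply: (EFav0 [set y | (y < c%:E)%E]).
  apply: open_nbhs_nbhs; split; first exact: open_ereal_lt_ereal.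
  by rewrite /= lte_fin.
apply: (@le_trans _ _ (ereal_sup [set (Fav_nbhd r omega s w / EFav_nbhd r omega s)%E |
    s in [set s | (EFav_nbhd r omega s < c%:E)%E /\ 0 < s]])).
  apply: ereal_inf_lbound; exists [set s | (EFav_nbhd r omega s < c%:E)%E /\ 0 < s] => //.
  by apply: filterI => //; exact: nbhs_right_gt.
apply: ge_ereal_sup => _ [s [sc s0] <-].
have [n [rho sn]] := exists_scale r_adm s0.
set E := energy n (truncate_radii r rho).
have E0 : 0 < E by rewrite /E; apply: (scale_energy_gt0 r_adm sn).
have lo := EFav_lower r_adm omega_ind sn.
have EM : 2 * (energy M r + 1) < E.
  have := le_lt_trans lo sc; rewrite lte_fin -/E /c ltr_pdivrMr//.
  have x0 : 0 < 15 * (energy M r + 1) by rewrite -invr_gt0.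
  by rewrite -(ltr_pM2r x0) [ltRHS]mulrAC mulVf ?gt_eqF// mul1r; lra.
have b0 : 0 < 2 / 15 / E by rewrite !divr_gt0.
have C0 : 0 <= 1000 * 1000 :> R by rewrite mulr_ge0 ?ler0n.
have [det|[k int]] := scale_dichotomy r_adm sn.
  apply: (ratio_le b0 C0 _ (det (fun i => omega i w)) lo).
  rewrite -/E mulrA ler_pM2r ?invr_gt0//; lra.
have Mk : (M <= k)%N.
  rewrite leqNgt; apply/negP => kM; have [_ _ h _] := int.
  by have := le_energy r0 kM; move: EM h; rewrite /E; lra.
have Fk := NM k s Mk (conj s0 (ex_intro _ n (ex_intro _ rho (conj sn int)))).
apply: (ratio_le b0 C0 _ Fk lo).
have [_ e1 e2 _] := int.
have e0 : 0 < energy k.+1 r by move: e2 E0; rewrite /E; lra.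
rewrite ler_pdivrMr// -/E mulrAC mulrA ler_pdivlMr//.
move: e2; rewrite -/E => e2; lra.
Qed.
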